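(* Let $r \geq 3$ and $\ell \geq 2$ be integers. There exist a constant $c > 0$ (depending on $r$, resp. $\ell$) and $k_0$ such that for every fixed integer $k \geq k_0$ the following holds. For each $n$ let $G = G_n$ be an $n$-vertex graph with maximum degree $\Delta := \Delta(n)$ and let $m := m(n)$ be an integer with $m \geq 3k^2\Delta$. (a) If $G$ is $K_r$-free and $m / \left(n^{c k^{-(2r-3)/(r-2)} (\log k)^{1/(r-2)}} \Delta^{2/k}\right) \to \infty$, then $G$ is a.a.s. $(k,m)$-colourable. (b) If $G$ is $C_{2\ell+1}$-free and $m / \left(n^{c k^{-(\ell+2)} (\log k)^{\ell}} \Delta^{2/k}\right) \to \infty$, then $G$ is a.a.s. $(k,m)$-colourable. (c) If $G$ is $C_{2\ell}$-free and $m / \left(n^{c k^{-(\ell+1)}} \Delta^{2/k}\right) \to \infty$, then $G$ is a.a.s. $(k,m)$-colourable.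
   Context: A random $(k,m)$-list-assignment $\mathcal{L} = \{L(v)\}$ of a graph $G$ assigns to each vertex a uniformly random $k$-element subset of $\{1,\ldots,m\}$, independently over vertices. $G$ is a.a.s. $(k,m)$-colourable if $\lim_{n\to\infty}\mathbb{P}(G$ has a proper colouring $c$ with $c(v)\in L(v)$ for all $v) = 1$. $H$-free means containing no (not necessarily induced) copy of $H$. $\log$ is the natural logarithm. *)

(* Defs.v *)
From HB Require Import structures.
From mathcomp Require Import all_boot all_order all_algebra.
From mathcomp Require Import all_classical all_reals all_analysis.
Set Implicit Arguments. Unset Strict Implicit. Unset Printing Implicit Defensive.
Import Order.TTheory GRing.Theory Num.Theory.
Import numFieldNormedType.Exports.
Local Open Scope classical_set_scope.
Local Open Scope ring_scope.

Definition simple_graph (n : nat) (G : rel 'I_n) : Prop :=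
  symmetric G /\ irreflexive G.

Definition maxdeg (n : nat) (G : rel 'I_n) : nat :=
  (\max_(v : 'I_n) #|[set u | G v u]|)%N.

Definition contains_copy (h n : nat) (H : rel 'I_h) (G : rel 'I_n) : Prop :=
  exists f : 'I_h -> 'I_n, injective f /\ (forall i j, H i j -> G (f i) (f j)).

Definition H_free (h n : nat) (H : rel 'I_h) (G : rel 'I_n) : Prop :=
  ~ contains_copy H G.

Definition complete_graph (r : nat) : rel 'I_r := fun i j => i != j.

Definition cycle_graph (p : nat) : rel 'I_p :=
  fun i j => (nat_of_ord j == (i.+1 %% p)%N) || (nat_of_ord i == (j.+1 %% p)%N).

Definition is_list_assignment (k n m : nat) (L : {ffun 'I_n -> {set 'I_m}}) : bool :=
  [forall v, #|L v| == k].

Definition list_colourable (n m : nat) (G : rel 'I_n) (L : {ffun 'I_n -> {set 'I_m}}) : bool :=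
  [exists c : {ffun 'I_n -> 'I_m},
     [forall v, c v \in L v] && [forall u, forall v, G u v ==> (c u != c v)]].

Definition prob_colourable (R : realType) (k n m : nat) (G : rel 'I_n) : R :=
  (#|[set L : {ffun 'I_n -> {set 'I_m}} | is_list_assignment k L && list_colourable G L]|%:R
   / #|[set L : {ffun 'I_n -> {set 'I_m}} | is_list_assignment k L]|%:R).

Definition aas_colourable (R : realType) (k : nat) (G : forall n, rel 'I_n) (m : nat -> nat) : Prop :=
  (fun n => prob_colourable R k (m n) (G n)) @ \oo --> (1 : R).

Definition threshold_diverges (R : realType) (k : nat) (e : R)
  (G : forall n, rel 'I_n) (m : nat -> nat) : Prop :=
  (fun n => (m n)%:R / (powR (n%:R : R) e * powR ((maxdeg (G n))%:R : R) (2 / k%:R)))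
     @ \oo --> +oo.

(* Main.v *)
Require Import Defs.
From HB Require Import structures.
From mathcomp Require Import all_boot all_order all_algebra.
From mathcomp Require Import all_classical all_reals all_analysis.
From mathcomp Require Import fintype finset.
From mathcomp Require Import zify ring lra.
Import Order.TTheory GRing.Theory Num.Theory.
Local Open Scope ring_scope.
Set Implicit Arguments.
Unset Strict Implicit.
Unset Printing Implicit Defensive.

(** A minimal set [S] of vertices that cannot be coloured from the random lists is connected through
    edges with intersecting lists, and every colour of a list in [S] occurs on a second vertex of [S].
    Since [m >= 3 k^2 Delta], the intersecting edges form a subcritical percolation, so [|S|] is at most
    logarithmic in [n]. The lists in [S] use at most [k |S| / 2] colours, so the expected number of such
    [S] with [|S| = s] is about [n (Delta^2 polylog(n) / m^k)^(s/2)]. Hence, if every set of fewer than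
    [N0] vertices is [k]-choosable, an excess factor [n^(12/(k N0))] over [Delta^(2/k)] suffices.

    It remains to bound [N0] from below. A [K_r]-free graph on [t^(r-1)] vertices has chromatic number
    [O(t^(r-2))]; a [C_(2l+1)]-free graph on [t^(l+1)] vertices has fractional chromatic number [O(t)],
    by breadth-first search. Such bounds imply choosability with the loss of only part of a logarithm:
    split the colours at random into two halves; the first half leaves uncoloured a fraction
    [1 / log k] of the vertices, for which the bound is better by a power of [log k], enough for the
    second half to finish. For [C_(2l)]-free graphs, degeneracy suffices: in a bipartite subgraph of
    minimum degree [d], breadth-first levels grow by a factor of order [d] up to level [l]. *)

(** * List colourings and fractional colourings *)

(** Greedy list colouring of a set [S] with fractional chromatic number [q] leaves about
    [|S| exp(-k/q)] vertices uncoloured, so it asks for [k] of order [q log |S|]. If sets of [t^a]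
    vertices have [q = O(t^b)], this reaches only sizes [(k / log k)^(a/b)]. With two phases, the
    first one has to gain only a power of [log k], so [t] may be replaced by [t z] with [z^a] close
    to [log k]. The size reached is then [(k / log k)^(a/b) log k], whence the exponents of [log k]
    in the theorem. Fractional bounds suffice because the greedy choice only asks, for each colour,
    for one heavy stable set.

    Write [e] for the exponent of [n] in the condition on [m]. A vertex of a bad set then
    contributes a factor of about [n^(-ek/2)] times a power of [log n]. Half of the exponent absorbs
    the logarithms; the other half must give [n^(-3)] over [s] vertices, so [e k s / 4 >= 3], which
    is the origin of 12. The 3 in [3 k^2 Delta] is there to exceed Euler's number: the exploration
    potential costs a factor [(1 + 1/Delta)^Delta]. *)

Definition stable (n : nat) (G : rel 'I_n) (I : {set 'I_n}) : bool :=
  [forall u in I, forall v in I, ~~ G u v].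

Lemma stableP (n : nat) (G : rel 'I_n) (I : {set 'I_n}) :
  reflect (forall u v, u \in I -> v \in I -> ~~ G u v) (stable G I).
Proof.
apply: (iffP forall_inP) => [h u v uI vI|h u uI].
  by have /forall_inP := h u uI; apply.
by apply/forall_inP => v vI; apply: h.
Qed.

Definition colourable_on (n : nat) (C : finType) (G : rel 'I_n)
  (L : 'I_n -> {set C}) (S : {set 'I_n}) : bool :=
  [exists c : {ffun 'I_n -> C}, [forall v in S, c v \in L v] &&
     [forall u in S, forall v in S, G u v ==> (c u != c v)]].

Lemma colourable_onP (n : nat) (C : finType) (G : rel 'I_n)
    (L : 'I_n -> {set C}) (S : {set 'I_n}) :
  reflect (exists c : 'I_n -> C, (forall v, v \in S -> c v \in L v) /\
             (forall u v, u \in S -> v \in S -> G u v -> c u != c v))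
          (colourable_on G L S).
Proof.
apply: (iffP existsP) => [[c /andP[/forall_inP h1 /forall_inP h2]]|[c [h1 h2]]].
  exists c; split=> // u v uS vS guv.
  by have /forall_inP/(_ v vS)/implyP := h2 u uS; apply.
exists (finfun c); apply/andP; split.
  by apply/forall_inP => v vS; rewrite ffunE; apply: h1.
apply/forall_inP => u uS; apply/forall_inP => v vS; apply/implyP => guv.
by rewrite !ffunE; apply: h2.
Qed.

Lemma colourable_on0 (n : nat) (C : finType) (c0 : C) (G : rel 'I_n)
    (L : 'I_n -> {set C}) : colourable_on G L set0.
Proof.
apply/colourable_onP; exists (fun=> c0).
by split=> [v|u v]; rewrite in_set0.
Qed.

Lemma colourable_degenerate (n k : nat) (C : finType) (c0 : C) (G : rel 'I_n)
    (L : 'I_n -> {set C}) (S : {set 'I_n}) :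
  symmetric G -> irreflexive G ->
  (forall v, v \in S -> (k <= #|L v|)%N) ->
  (forall S' : {set 'I_n}, S' \subset S -> S' != set0 ->
     exists2 v, v \in S' & (#|[set u in S' | G v u]| < k)%N) ->
  colourable_on G L S.
Proof.
move=> Gs Gi; have [j] := ubnP #|S|; elim: j S => // j IH S; rewrite ltnS => Sj hL hdeg.
have [->|Sn0] := eqVneq S set0; first exact: colourable_on0.
have [v vS dv] := hdeg S (subxx _) Sn0.
have sub : S :\ v \subset S by rewrite subD1set.
have /colourable_onP[c [c1 c2]] : colourable_on G L (S :\ v).
  apply: IH.
  - by move: Sj; rewrite (cardsD1 v) vS.
  - by move=> u /(subsetP sub); apply: hL.
  - by move=> S' /subset_trans/(_ sub); apply: hdeg.
have [d dL dN] : exists2 d, d \in L v & d \notin [set c u | u in [set u in S | G v u]].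
  apply/subsetPn; apply/negP => /subset_leq_card.
  apply/negP; rewrite -ltnNge; apply: leq_ltn_trans (leq_imset_card _ _) _.
  exact: leq_trans dv (hL v vS).
have dc u : u \in S -> G v u -> c u != d.
  move=> uS gvu; apply: contra dN => /eqP <-; apply: imset_f.
  by rewrite inE uS.
apply/colourable_onP; exists (fun u => if u == v then d else c u); split=> [u uS|u w uS wS guw].
  by case: eqVneq => [->//|uv]; apply: c1; rewrite !inE uv.
case: (eqVneq u v) => [uv|uv]; case: (eqVneq w v) => [wv|wv].
- by move: guw; rewrite uv wv Gi.
- by rewrite eq_sym; apply: dc => //; rewrite -uv.
- by apply: dc => //; rewrite -wv Gs.
- by apply: c2; rewrite ?inE ?uv ?wv.
Qed.

Definition proper_on (n : nat) (C : eqType) (G : rel 'I_n) (S : {set 'I_n})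
  (f : 'I_n -> C) : Prop :=
  forall u v, u \in S -> v \in S -> G u v -> f u != f v.

(* [S] has fractional chromatic number at most [q], in its dual (weighted) form. *)
Definition frac_chi_le (R : realType) (n : nat) (G : rel 'I_n) (S : {set 'I_n})
  (q : R) : Prop :=
  forall w : 'I_n -> R, (forall v, 0 <= w v) ->
  exists I : {set 'I_n}, [/\ I \subset S, stable G I &
    \sum_(v in S) w v <= q * \sum_(v in I) w v].

(** Extend the weights by zero outside [S'] and cut the stable set down to [S']. *)
Lemma frac_chi_leS (R : realType) (n : nat) (G : rel 'I_n) (S S' : {set 'I_n}) (q : R) :
  S' \subset S -> frac_chi_le G S q -> frac_chi_le G S' q.
Proof.
move=> sub h w w0.
have [|I [IS stI hI]] := h (fun v => if v \in S' then w v else 0).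
  by move=> v; case: ifP.
exists (I :&: S'); split; first exact: subsetIr.
  apply/stableP => u v; rewrite !inE => /andP[uI _] /andP[vI _].
  by move/stableP: stI; apply.
have e1 : \sum_(v in S) (if v \in S' then w v else 0) = \sum_(v in S') w v.
  rewrite -big_mkcondr; apply: eq_bigl => v.
  by case vS': (v \in S'); rewrite ?andbF // (subsetP sub).
have e2 : \sum_(v in I) (if v \in S' then w v else 0) = \sum_(v in I :&: S') w v.
  by rewrite -big_mkcondr; apply: eq_bigl => v; rewrite inE.
by rewrite -e1 -e2.
Qed.

(** The heaviest colour class serves. *)
Lemma frac_chi_le_proper (R : realType) (n : nat) (C : finType) (G : rel 'I_n)
    (S : {set 'I_n}) (f : 'I_n -> C) :
  proper_on G S f -> frac_chi_le G S (#|C|%:R : R).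
Proof.
move=> pf w w0.
have [->|/set0Pn[v0 v0S]] := eqVneq S set0.
  exists set0; split; rewrite ?sub0set ?big_set0 ?mulr0 //.
  by apply/stableP => u v; rewrite in_set0.
pose F (c : C) := \sum_(v in S | f v == c) w v.
pose cm := [arg max_(c > f v0) F c]%O.
have Fm c : F c <= F cm.
  by rewrite /cm; case: arg_maxP => // i _ /(_ c isT).
exists [set v in S | f v == cm]; split.
- by apply/subsetP => v; rewrite inE => /andP[].
- apply/stableP => u v; rewrite !inE => /andP[uS /eqP fu] /andP[vS /eqP fv].
  by apply/negP => /(pf u v uS vS); rewrite fu fv eqxx.
rewrite (partition_big f xpredT) //= -sum1_card natr_sum mulr_suml.
apply: ler_sum => c _; rewrite mul1r.
rewrite [leRHS](eq_bigl (fun v => (v \in S) && (f v == cm))) ?Fm //.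
by move=> v; rewrite inE.
Qed.

(** Conditional expectations: an uncovered vertex weighs [1 - 1/q] to the number of its list colours
    still to come. The next colour [c] goes to a stable set carrying a fraction [1/q] of the weight
    of the vertices whose lists contain [c], which pays for the rise of their weights. At the end
    each uncovered vertex weighs 1. *)
Lemma cover_phase (R : realType) (n : nat) (C : finType) (G : rel 'I_n)
    (L : 'I_n -> {set C}) (q : R) (cs : seq C) (U : {set 'I_n}) :
  1 <= q -> frac_chi_le G U q -> uniq cs ->
  exists I : C -> {set 'I_n}, [/\ forall c, stable G (I c),
    forall c v, v \in I c -> (c \in L v) && (c \in cs) &
    #|[set v in U | [forall c, v \notin I c]]|%:R <=
      \sum_(v in U) (1 - q^-1) ^+ (count (mem (L v)) cs)].
Proof.
move=> q1; have q0 : 0 < q by lra.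
have r0 : 0 <= 1 - q^-1 by rewrite subr_ge0 invf_le1.
elim: cs U => [|c cs IH] U hU ucs.
  exists (fun=> set0); split=> [c|c v|].
  - by apply/stableP => u v; rewrite in_set0.
  - by rewrite in_set0.
  rewrite -sum1_card natr_sum /=; under [leRHS]eq_bigr do rewrite expr0.
  rewrite le_eqVlt; apply/orP; left; apply/eqP; apply: eq_bigl => v.
  rewrite inE; case: (v \in U) => //=; apply/forallP => c; by rewrite in_set0.
move: ucs => /= /andP[ccs ucs].
pose Uc := [set v in U | c \in L v].
have UcU : Uc \subset U by apply/subsetP => v; rewrite inE => /andP[].
pose w v := (1 - q^-1) ^+ (count (mem (L v)) cs).
have w0 v : 0 <= w v by apply: exprn_ge0.
have [I0 [I0U stI0 hI0]] := frac_chi_leS UcU hU w0.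
have I0U' : I0 \subset U by apply: subset_trans UcU.
have [|I [I1 I2 I3]] := IH (U :\: I0) _ ucs.
  by apply: frac_chi_leS hU; apply: subsetDl.
exists (fun d => if d == c then I0 else I d); split.
- by move=> d; case: ifP.
- move=> d v; case: eqVneq => [->|dc].
    by move=> /(subsetP I0U); rewrite !inE eqxx => /andP[_ ->].
  by move=> /I2/andP[-> h]; rewrite inE h orbT.
have -> : [set v in U | [forall d, v \notin (if d == c then I0 else I d)]] =
     [set v in U :\: I0 | [forall d, v \notin I d]].
  apply/setP => v; rewrite !inE; case vU: (v \in U); rewrite ?andbF //= ?andbT.
  apply/forallP/andP => [h|[vI0 /forallP h] d].
    split; first by have := h c; rewrite eqxx.
    apply/forallP => d; have := h d; case: eqVneq => // -> _.
    by apply/negP => /I2/andP[_]; rewrite (negbTE ccs).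
  by case: eqVneq => // _; apply: h.
apply: le_trans I3 _.
have e1 : \sum_(v in U) w v = \sum_(v in I0) w v + \sum_(v in U :\: I0) w v.
  by rewrite (big_setID I0) /= (setIidPr I0U').
have e2 : \sum_(v in U) w v = \sum_(v in Uc) w v + \sum_(v in U :\: Uc) w v.
  by rewrite (big_setID Uc) /= (setIidPr UcU).
have e3 : \sum_(v in U) (1 - q^-1) ^+ (count (mem (L v)) (c :: cs)) =
    (1 - q^-1) * \sum_(v in Uc) w v + \sum_(v in U :\: Uc) w v.
  rewrite (big_setID Uc) /= (setIidPr UcU) mulr_sumr; congr (_ + _).
    by apply: eq_bigr => v; rewrite inE => /andP[_ cv]; rewrite /= cv exprS.
  apply: eq_bigr => v; rewrite !inE => /andP[h vU]; move: h; rewrite vU /= => h.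
  by rewrite (negbTE h).
rewrite -/w e3.
suff : q^-1 * \sum_(v in Uc) w v <= \sum_(v in I0) w v by lra.
by rewrite ler_pdivrMl.
Qed.

(* Derandomised fair splitting of the colour set; [x] is the base of the exponential moment. *)
Lemma split_potential (R : realType) (n : nat) (C : finType) (S : {set 'I_n})
    (L : 'I_n -> {set C}) (x : R) (cs : seq C) (al be : 'I_n -> R) :
  0 <= x -> (forall v, 0 <= al v) -> (forall v, 0 <= be v) -> uniq cs ->
  exists2 A : {set C}, A \subset cs &
    \sum_(v in S) (al v * x ^+ count (fun c => (c \in L v) && (c \in A)) cs +
                   be v * x ^+ count (fun c => (c \in L v) && (c \notin A)) cs) <=
    \sum_(v in S) (al v + be v) * ((1 + x) / 2) ^+ count (mem (L v)) cs.
Proof.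
move=> x0; elim: cs al be => [|c cs IH] al be al0 be0 ucs.
  exists set0; first by apply/subsetP => c; rewrite in_set0.
  by apply: ler_sum => v _ /=; rewrite !expr0 !mulr1.
move: ucs => /= /andP[ccs ucs].
pose y := (1 + x) / 2; pose N v := count (mem (L v)) cs.
pose a1 v := if c \in L v then al v * x else al v.
pose b1 v := if c \in L v then be v * x else be v.
have a10 v : 0 <= a1 v by rewrite /a1; case: ifP => // _; rewrite mulr_ge0.
have b10 v : 0 <= b1 v by rewrite /b1; case: ifP => // _; rewrite mulr_ge0.
have [A1 A1c hA1] := IH a1 be a10 be0 ucs.
have [A2 A2c hA2] := IH al b1 al0 b10 ucs.
pose s1 := \sum_(v in S) (a1 v + be v) * y ^+ N v.
pose s2 := \sum_(v in S) (al v + b1 v) * y ^+ N v.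
pose s := \sum_(v in S) (al v + be v) * y ^+ count (mem (L v)) (c :: cs).
(* Putting [c] into [A] or leaving it out gives [s] on average, so one of the two choices gives at
   most [s]. *)
have ss : s1 + s2 = 2 * s.
  rewrite /s1 /s2 /s -big_split mulr_sumr; apply: eq_bigr => v _ /=.
  by rewrite /a1 /b1 -/(N v); case: (c \in L v) => /=; rewrite ?exprS /y; field.
have [h|h] := leP s1 s.
  exists (c |: A1).
    apply/subsetP => d; rewrite !inE; case: eqVneq => //= dc dA.
    by move/subsetP: A1c => /(_ d dA).
  apply: le_trans h; apply: le_trans hA1; apply: ler_sum => v _ /=.
  rewrite !inE eqxx /= andbT andbF add0n.
  have e1 : count (fun d => (d \in L v) && (d \in c |: A1)) cs =
            count (fun d => (d \in L v) && (d \in A1)) cs.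
    by apply: eq_in_count => d dcs; rewrite !inE; case: eqVneq => // dc; rewrite -dc dcs in ccs.
  have e2 : count (fun d => (d \in L v) && (d \notin c |: A1)) cs =
            count (fun d => (d \in L v) && (d \notin A1)) cs.
    by apply: eq_in_count => d dcs; rewrite !inE; case: eqVneq => // dc; rewrite -dc dcs in ccs.
  by rewrite e1 e2 /a1; case: (c \in L v); rewrite ?exprS ?mulrA.
have cA2 : c \notin A2 by apply/negP => /(subsetP A2c); rewrite (negbTE ccs).
exists A2.
  by apply/subsetP => d dA; rewrite inE; move/subsetP: A2c => /(_ d dA) ->; rewrite orbT.
apply: (@le_trans _ _ s2); last by rewrite -/y -/s; lra.
apply: le_trans hA2; apply: ler_sum => v _ /=.
rewrite (negbTE cA2) /= andbF andbT add0n /b1.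
by case: (c \in L v); rewrite ?exprS ?mulrA.
Qed.

Lemma count_enum_card (T : finType) (A B : {set T}) :
  count (mem A) (enum B) = #|A :&: B|.
Proof.
rewrite cardE -size_filter; apply/perm_size/uniq_perm.
- by rewrite filter_uniq // enum_uniq.
- exact: enum_uniq.
- by move=> c; rewrite mem_filter !mem_enum in_setI.
Qed.

(** A half holding fewer than [k / 4] colours of a list contributes at least [z^k] to the potential,
    as [x = z^4]. The total is at most [2 |S| ((1 + x) / 2)^k], and for [z = 3/4] one has
    [(1 + x) / 2 = (337 / 384) z], so it stays below [z^k]. *)
Lemma split_lists (R : realType) (n k : nat) (C : finType) (S : {set 'I_n})
    (L : 'I_n -> {set C}) :
  (forall v, v \in S -> #|L v| = k) -> 2 * #|S|%:R * (337 / 384) ^+ k < 1 :> R ->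
  exists A : {set C}, forall v, v \in S ->
    (k <= 4 * #|L v :&: A|)%N /\ (k <= 4 * #|L v :&: ~: A|)%N.
Proof.
move=> hL small; pose z : R := 3 / 4; pose x := z ^+ 4.
have z0 : 0 < z by rewrite /z; lra.
have z1 : z <= 1 by rewrite /z; lra.
have x0 : 0 <= x by apply: exprn_ge0; lra.
have [A _ hA] := split_potential S L x0 (fun=> ler01) (fun=> ler01)
  (enum_uniq [set: C]).
exists A; have cE (B : {set C}) v : count (fun c => (c \in L v) && (c \in B)) (enum [set: C]) =
    #|L v :&: B|.
  by rewrite -[L v :&: B]setIT -count_enum_card; apply: eq_count => c; rewrite /= in_setI.
have cE' v : count (fun c => (c \in L v) && (c \notin A)) (enum [set: C]) =
    #|L v :&: ~: A|.
  by rewrite -cE; apply: eq_count => c; rewrite !inE.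
have y1 : (1 + x) / 2 = z * (337 / 384) by rewrite /x /z; field.
have tot : \sum_(v in S) (x ^+ #|L v :&: A| + x ^+ #|L v :&: ~: A|) < z ^+ k.
  apply: (@le_lt_trans _ _ (2 * #|S|%:R * (337 / 384) ^+ k * z ^+ k)); last first.
    by rewrite -[ltRHS]mul1r ltr_pM2r // exprn_gt0.
  move: hA; under eq_bigr do rewrite !mul1r cE cE'; move/le_trans; apply.
  rewrite -sum1_card natr_sum mulr_sumr !mulr_suml; apply: ler_sum => v vS.
  by rewrite count_enum_card setIT hL // y1 exprMn; lra.
have xk a : (4 * a < k)%N -> z ^+ k <= x ^+ a.
  by move=> ak; rewrite /x -exprM; apply: ler_wiXn2l; [exact: ltW|exact: z1|exact: ltnW].
have bound v : v \in S -> x ^+ #|L v :&: A| + x ^+ #|L v :&: ~: A| < z ^+ k.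
  move=> vS; apply: le_lt_trans tot; rewrite (bigD1 v) //= lerDl.
  by apply: sumr_ge0 => u _; rewrite addr_ge0 // exprn_ge0.
move=> v vS; have := bound v vS.
have p1 : 0 <= x ^+ #|L v :&: A| by apply: exprn_ge0.
have p2 : 0 <= x ^+ #|L v :&: ~: A| by apply: exprn_ge0.
by move=> b; split; rewrite leqNgt; apply/negP => /xk h; lra.
Qed.

Lemma cover_colourable (n : nat) (C : finType) (c0 : C) (G : rel 'I_n)
    (L : 'I_n -> {set C}) (S : {set 'I_n}) (I : C -> {set 'I_n}) :
  (forall c, stable G (I c)) -> (forall c v, v \in I c -> c \in L v) ->
  (forall v, v \in S -> exists c, v \in I c) -> colourable_on G L S.
Proof.
move=> stI IL cov; pose f v := odflt c0 [pick c | v \in I c].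
have fI v : v \in S -> v \in I (f v).
  rewrite /f; case: pickP => /= [c vIc _ //|h /cov[c vIc]].
  by have := h c; rewrite /= vIc.
apply/colourable_onP; exists f; split=> [v vS|u v uS vS guv]; first by apply/IL/fI.
apply: contraTneq guv => fuv; have /stableP := stI (f u); apply; first exact: fI.
by rewrite fuv fI.
Qed.

Lemma pow_le_expR (R : realType) (q : R) (k a : nat) :
  1 <= q -> (k <= 4 * a)%N -> (1 - q^-1) ^+ a <= expR (- (k%:R / (4 * q))).
Proof.
move=> q1 ka; have q0 : 0 < q by lra.
have qi : 0 <= q^-1 by rewrite invr_ge0 ltW.
apply: (@le_trans _ _ (expR (- q^-1) ^+ a)).
  by rewrite lerXn2r ?nnegrE ?expR_ge0 ?expR_ge1Dx // subr_ge0 invf_le1.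
rewrite -expRM_natl ler_expR mulrN lerN2 invfM mulrA ler_wpM2r // ler_pdivrMr //.
by rewrite -natrM ler_nat mulnC.
Qed.

(* First colour from [A] with the bound [q1]; what is left is so small that the better bound [q2]
   lets the colours outside [A] finish. This saves the usual factor [log #|S|]. *)
Lemma two_phase (R : realType) (n k : nat) (C : finType) (c0 : C) (G : rel 'I_n)
    (L : 'I_n -> {set C}) (S : {set 'I_n}) (q1 q2 : R) (N : nat) :
  1 <= q1 -> 1 <= q2 -> frac_chi_le G S q1 ->
  (forall U : {set 'I_n}, U \subset S -> (#|U| <= N)%N -> frac_chi_le G U q2) ->
  (forall v, v \in S -> #|L v| = k) -> 2 * #|S|%:R * (337 / 384) ^+ k < 1 :> R ->
  #|S|%:R * expR (- (k%:R / (4 * q1))) < N.+1%:R ->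
  N%:R * expR (- (k%:R / (4 * q2))) < 1 ->
  colourable_on G L S.
Proof.
move=> q11 q21 f1 f2 hL small h1 h2.
have [A hA] := split_lists hL small.
have [I [I1 I2 I3]] := cover_phase L q11 f1 (enum_uniq A).
set U := [set v in S | _] in I3.
have US : U \subset S by apply/subsetP => v; rewrite inE => /andP[].
have UN : (#|U| <= N)%N.
  rewrite -ltnS -(ltr_nat R); apply: le_lt_trans h1; apply: le_trans I3 _.
  rewrite -sum1_card natr_sum mulr_suml; apply: ler_sum => v vS.
  rewrite mul1r count_enum_card; apply: pow_le_expR => //.
  by have [] := hA v vS.
have [J [J1 J2 J3]] := cover_phase L q21 (f2 U US UN) (enum_uniq (~: A)).
set W := [set v in U | _] in J3.
have W0 : W = set0.
  apply/eqP; rewrite -cards_eq0 -leqn0 -ltnS -(ltr_nat R); apply: le_lt_trans J3 _.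
  apply: le_lt_trans h2.
  apply: (@le_trans _ _ (#|U|%:R * expR (- (k%:R / (4 * q2))))); last first.
    by rewrite ler_wpM2r ?expR_ge0 // ler_nat.
  rewrite -sum1_card natr_sum mulr_suml; apply: ler_sum => v /(subsetP US) vS.
  rewrite mul1r count_enum_card; apply: pow_le_expR => //.
  by have [] := hA v vS.
apply: (@cover_colourable _ _ c0 _ _ _ (fun c => if c \in A then I c else J c)).
- by move=> c; case: ifP.
- by move=> c v; case: ifP => _; [case/I2/andP|case/J2/andP].
move=> v vS; case vU: (v \in U); last first.
  move: vU; rewrite inE vS /= => /negbT; rewrite negb_forall => /existsP[c].
  rewrite negbK => vI; exists c; have /andP[_] := I2 c v vI.
  by rewrite mem_enum => ->.
have : v \notin W by rewrite W0 in_set0.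
rewrite inE vU /= negb_forall => /existsP[c]; rewrite negbK => vJ; exists c.
by have /andP[_] := J2 c v vJ; rewrite mem_enum inE => /negbTE ->.
Qed.

(** * Clique-free graphs *)

Definition clique_on (n : nat) (G : rel 'I_n) (K : {set 'I_n}) : Prop :=
  forall u v, u \in K -> v \in K -> u != v -> G u v.

Lemma H_free_clique (n r : nat) (G : rel 'I_n) (K : {set 'I_n}) :
  H_free (@complete_graph r) G -> clique_on G K -> #|K| <> r.
Proof.
move=> hf cl Kr; apply: hf.
have e : r = #|K| by [].
exists (fun i => enum_val (cast_ord e i)); split.
  by move=> i j /enum_val_inj/cast_ord_inj.
move=> i j ij; apply: cl; rewrite ?enum_valP //.
by apply: contra ij => /eqP/enum_val_inj/cast_ord_inj ->.
Qed.

Lemma greedy_proper (n D : nat) (G : rel 'I_n) (S : {set 'I_n}) :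
  symmetric G -> irreflexive G -> (0 < D)%N ->
  (forall v, v \in S -> (#|[set u in S | G v u]| < D)%N) ->
  exists2 f : 'I_n -> nat, proper_on G S f & forall v, (f v < D)%N.
Proof.
move=> Gs Gi D0 hD; case: D D0 hD => // D _ hD.
have /colourable_onP[c [_ hc]] : colourable_on G (fun=> [set: 'I_D.+1]) S.
  apply: (@colourable_degenerate _ D.+1 _ ord0) => //.
    by move=> v _; rewrite cardsT card_ord.
  move=> S' sub /set0Pn[v vS']; exists v => //.
  apply: leq_ltn_trans (hD v (subsetP sub v vS')); apply: subset_leq_card.
  by apply/subsetP => u; rewrite !inE => /andP[/(subsetP sub) -> ->].
exists (fun v => nat_of_ord (c v)); last by move=> v; apply: ltn_ord.
by move=> u v uS vS guv; apply: contra (hc u v uS vS guv) => /eqP/val_inj ->.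
Qed.

(* While some degree is at least [D = t ^ s.+1], the neighbourhood is [K_{s+2}]-free and receives
   its own palette, at most [t] times; afterwards [D] colours suffice greedily. *)
Lemma clique_free_proper (n t s : nat) (G : rel 'I_n) (S : {set 'I_n}) :
  symmetric G -> irreflexive G -> (0 < t)%N ->
  (forall K : {set 'I_n}, K \subset S -> clique_on G K -> #|K| <> s.+2) ->
  (#|S| <= t ^ s.+1)%N ->
  exists2 f : 'I_n -> nat, proper_on G S f & forall v, (f v < s.+1 * t ^ s)%N.
Proof.
move=> Gs Gi t0; elim: s S => [|s IH] S hK hS.
  exists (fun=> 0%N) => // u v uS vS guv; exfalso.
  have uv : u != v by apply: contraTneq guv => ->; rewrite Gi.
  apply: (hK [set u; v]); last by rewrite cards2 uv.
    by apply/subsetP => w; rewrite !inE => /orP[] /eqP ->.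
  move=> a b; rewrite !inE => /orP[] /eqP -> /orP[] /eqP ->; rewrite ?eqxx //.
  by rewrite Gs.
set D := (t ^ s.+1)%N in IH hS *; have D0 : (0 < D)%N by rewrite expn_gt0 t0.
(* Each round removes [D] vertices, so [t] rounds exhaust [S]. The palettes add up to
   [t * (s.+1 * t ^ s) + D = s.+2 * t ^ s.+1]. *)
suff rounds j (S' : {set 'I_n}) : S' \subset S -> (#|S'| <= j * D)%N ->
    exists2 f : 'I_n -> nat, proper_on G S' f &
      forall v, (f v < j * (s.+1 * t ^ s) + D)%N.
  have [|f f1 f2] := rounds t S (subxx _); first by rewrite -expnS.
  exists f => // v; apply: leq_trans (f2 v) _.
  by rewrite /D expnS; nia.
elim: j S' => [|j IHj] S' sub hS'.
  exists (fun=> 0%N) => // u v; have -> : S' = set0 by apply/eqP; rewrite -cards_eq0; lia.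
  by rewrite in_set0.
have [/existsP[v /andP[vS' dv]]|] := boolP [exists v, (v \in S') && (D <= #|[set u in S' | G v u]|)%N]; last first.
  rewrite negb_exists => /forallP h.
  have [v vS'|f f1 f2] := greedy_proper (S := S') Gs Gi D0.
    by have := h v; rewrite vS' /= -ltnNge.
  by exists f => // v; have := f2 v; lia.
have [X XN XD] : exists2 X : {set 'I_n}, X \subset [set u in S' | G v u] & #|X| = D.
  have [X /andP[]] : {X : {set 'I_n} | (X \subset [set u in S' | G v u]) && (#|X| == D)}.
    apply/sigW; exists [set x in take D (enum [set u in S' | G v u])].
    apply/andP; split.
      by apply/subsetP => x; rewrite inE => /mem_take; rewrite mem_enum.
    rewrite cardsE; apply/eqP; rewrite (card_uniqP _) ?take_uniq ?enum_uniq //.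
    by rewrite size_takel // -cardE.
  by move=> XN /eqP XD; exists X.
have XS' : X \subset S'.
  by apply: subset_trans XN _; apply/subsetP => u; rewrite inE => /andP[].
have gX u : u \in X -> G v u by move=> /(subsetP XN); rewrite inE => /andP[].
have [K KX cK| |f f1 f2] := IH X; last 1 first.
- have [||g g1 g2] := IHj (S' :\: X); [by apply: subset_trans sub; apply: subsetDl| |].
    by rewrite cardsD (setIidPr XS') XD; lia.
  set c := (s.+1 * t ^ s)%N in f2 g2 *.
  exists (fun u => if u \in X then f u else (c + g u)%N); last first.
    by move=> u; have := f2 u; have := g2 u; case: ifP => _; lia.
  move=> u w uS' wS' guw; case: ifP => uX; case: ifP => wX.
  + exact: f1.
  + by have := f2 u; lia.
  + by have := f2 w; lia.
  by rewrite eqn_add2l; apply: g1; rewrite // inE ?uX ?wX.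
- have vK : v \notin K by apply/negP => /(subsetP KX)/gX; rewrite Gi.
  have := hK (v |: K); rewrite cardsU1 vK /= => h Ks; apply: h; last by rewrite Ks.
    apply/subsetP => u; rewrite !inE => /orP[/eqP ->|/(subsetP KX)/(subsetP XS')];
    exact: (subsetP sub).
  move=> a b; rewrite !inE => /orP[/eqP ->|aK] /orP[/eqP ->|bK] ab.
  + by rewrite eqxx in ab.
  + by apply: gX; apply: (subsetP KX).
  + by rewrite Gs; apply: gX; apply: (subsetP KX).
  exact: cK.
by rewrite XD.
Qed.

Lemma frac_chi_clique_free (R : realType) (n t s : nat) (G : rel 'I_n) (S : {set 'I_n}) :
  symmetric G -> irreflexive G -> (0 < t)%N -> H_free (@complete_graph s.+2) G ->
  (#|S| <= t ^ s.+1)%N -> frac_chi_le G S ((s.+1 * t ^ s)%:R : R).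
Proof.
move=> Gs Gi t0 hf hS.
have [|f f1 f2] := @clique_free_proper n t s G S Gs Gi t0 _ hS.
  by move=> K _; apply: H_free_clique.
have := @frac_chi_le_proper R n 'I_(s.+1 * t ^ s) G S (fun v => Ordinal (f2 v)).
by rewrite card_ord; apply=> u v uS vS guv; apply: f1.
Qed.

(** * Breadth-first layers and cycles *)

Lemma contains_cycle (n : nat) (G : rel 'I_n) (s : seq 'I_n) :
  symmetric G -> uniq s -> cycle G s -> contains_copy (@cycle_graph (size s)) G.
Proof.
move=> Gs; case: s => [|x0 s] us cs; first by exists (fun i => let: Ordinal _ h := i in False_rect _ (elimF idP (ltn0 _) h)); split=> [[]|[]].
set t := x0 :: s in us *; exists (fun i : 'I_(size t) => nth x0 t i); split.
  by move=> i j /eqP; rewrite nth_uniq // => /eqP/val_inj.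
have step i j : (i < size t)%N -> j == (i.+1 %% size t)%N -> G (nth x0 t i) (nth x0 t j).
  move=> it /eqP ->; move: cs => /= /(pathP x0)/(_ i).
  rewrite size_rcons => /(_ it); rewrite -rcons_cons -/t !nth_rcons it.
  move: it; rewrite /= ltnS leq_eqVlt => /orP[/eqP ->|it].
    by rewrite ltnn eqxx modnn.
  by rewrite it modn_small.
move=> i j /orP[] h; first exact: step.
by rewrite Gs; apply: step.
Qed.

(** Levels are meaningful only up to [N]: vertices farther away, or outside [S], may carry any
    larger value. [P] is the parent map of a breadth-first tree with root [v]. *)
Definition layered (n : nat) (G : rel 'I_n) (S : {set 'I_n}) (N : nat) (v : 'I_n)
    (lev : 'I_n -> nat) (P : 'I_n -> 'I_n) : Prop :=
  [/\ lev v = 0%N, forall u, lev u = 0%N -> u = v,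
    forall u j, lev u = j.+1 -> (j < N)%N -> [/\ u \in S, P u \in S, lev (P u) = j & G (P u) u] &
    forall u w, u \in S -> w \in S -> (lev u < N)%N -> G u w -> (lev w <= (lev u).+1)%N].

Lemma bfs_layered (n : nat) (G : rel 'I_n) (S : {set 'I_n}) (N : nat) (v : 'I_n) :
  v \in S -> exists lev P, layered G S N v lev P.
Proof.
move=> vS; pose step B := B :|: [set u in S | [exists x in B, G x u]].
pose ball j := iter j step [set v].
have mono i j : (i <= j)%N -> ball i \subset ball j.
  move=> /subnK <-; elim: (j - i)%N => // d IH.
  by rewrite addSn; apply: subset_trans IH _; apply: subsetUl.
have ballS j : ball j \subset S.
  elim: j => [|j IH]; first by rewrite sub1set.
  by rewrite /= subUset IH /=; apply/subsetP => u; rewrite inE => /andP[].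
(* The index of the first ball containing [u], and [N.+1] if none does. *)
pose lev u := find (fun j => u \in ball j) (iota 0 N.+1).
have levE u j : (j <= N)%N -> (u \in ball j) = (lev u <= j)%N.
  move=> jN; apply/idP/idP => [uj|lj].
    rewrite leqNgt; apply/negP => lj; have := before_find 0%N lj.
    by rewrite nth_iota // add0n uj.
  have hs : has (fun j => u \in ball j) (iota 0 N.+1).
    by rewrite has_find size_iota -/(lev u) ltnS (leq_trans lj).
  have := nth_find 0%N hs; rewrite -/(lev u) nth_iota ?add0n; last by lia.
  by apply: (subsetP (mono _ _ lj)).
pose P u := odflt u [pick x | [&& x \in S, G x u & (lev x).+1 == lev u]].
exists lev, P; split.
- by apply/eqP; rewrite -leqn0 -levE // inE.
- move=> u lu; have : u \in ball 0%N by rewrite levE // lu.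
  by rewrite inE => /eqP.
- move=> u j lu jN.
  have uj : u \notin ball j by rewrite levE ?lu ?ltnn // ltnW.
  have uj1 : u \in ball j.+1 by rewrite levE ?lu.
  have uS : u \in S by apply: (subsetP (ballS _) _ uj1).
  move: (uj1); rewrite /ball iterS -/(ball j) in_setU (negbTE uj) /= inE uS /=.
  move=> /existsP[x /andP[xj gxu]].
  have xS : x \in S by apply: (subsetP (ballS _) _ xj).
  have lx : lev x = j.
    move: xj; rewrite levE ?(ltnW jN) // leq_eqVlt => /orP[/eqP//|xj].
    case: j => // j in jN lu uj uj1 xj *; case/negP: uj.
    rewrite /ball iterS -/(ball j) !inE uS /=; apply/orP; right.
    by apply/existsP; exists x; rewrite gxu andbT levE //; lia.
  rewrite /P; case: pickP => [y /and3P[yS gy /eqP]|/(_ x)] /=.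
    by rewrite lu => -[->].
  by rewrite xS gxu lx lu eqxx.
move=> u w uS wS lu guw; rewrite -levE //.
rewrite /ball iterS -/(ball (lev u)) !inE wS /=; apply/orP; right.
by apply/existsP; exists u; rewrite guw andbT levE // ltnW.
Qed.

(* [x] and [y] branch off at height [h.+1] of the tree given by the parent map [P], with [x] to the
   left of [y]. For fixed [h] this is transitive. *)
Definition left_of (n : nat) (P : 'I_n -> 'I_n) (h : nat) (x y : 'I_n) : bool :=
  (iter h.+1 P x == iter h.+1 P y) && (iter h P x < iter h P y)%N.

Lemma left_of_trans (n : nat) (P : 'I_n -> 'I_n) (h : nat) (y x z : 'I_n) :
  left_of P h x y -> left_of P h y z -> left_of P h x z.
Proof.
move=> /andP[/eqP e1 l1] /andP[/eqP e2 l2]; apply/andP; split; first by rewrite e1 e2.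
exact: ltn_trans l2.
Qed.

Lemma left_of_irr (n : nat) (P : 'I_n -> 'I_n) (h : nat) (x : 'I_n) : left_of P h x x = false.
Proof. by rewrite /left_of ltnn andbF. Qed.

Lemma layered_iter (n : nat) (G : rel 'I_n) (S : {set 'I_n}) (N : nat) (v : 'I_n)
    (lev : 'I_n -> nat) (P : 'I_n -> 'I_n) (x : 'I_n) (a : nat) :
  layered G S N v lev P -> (lev x <= N)%N -> (a <= lev x)%N ->
  lev (iter a P x) = (lev x - a)%N.
Proof.
move=> [_ _ hP _] xN; elim: a => [|a IH] ax; first by rewrite subn0.
have [||_ _ -> _] := hP (iter a P x) (lev x - a.+1)%N; rewrite ?IH //; lia.
Qed.

(** The ancestor lines meet at the root at the latest. One step before they first meet, the
    ancestors differ, and their order as ordinals decides which vertex is on the left. *)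
Lemma branch_height (n : nat) (G : rel 'I_n) (S : {set 'I_n}) (N : nat) (v : 'I_n)
    (lev : 'I_n -> nat) (P : 'I_n -> 'I_n) (x y : 'I_n) :
  layered G S N v lev P -> (lev x <= N)%N -> lev y = lev x -> x != y ->
  exists2 h, (h < lev x)%N & left_of P h x y || left_of P h y x.
Proof.
move=> lay xN yx xy; have [_ h0 _ _] := lay.
have ex : exists a, (iter a P x == iter a P y).
  exists (lev x); have -> : iter (lev x) P x = v.
    by apply: h0; rewrite (layered_iter lay) ?subnn.
  by rewrite eq_sym; apply/eqP/h0; rewrite (layered_iter lay) ?yx ?subnn.
have hmin : (ex_minn ex <= lev x)%N.
  case: ex_minnP => a _; apply; apply/eqP; transitivity v; last apply/esym.
    by apply: h0; rewrite (layered_iter lay) ?subnn.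
  by apply: h0; rewrite (layered_iter lay) ?yx ?subnn.
move: hmin; case: ex_minnP => -[|a] /eqP ea amin ax; first by rewrite /= in ea; rewrite ea eqxx in xy.
exists a => //; rewrite /left_of -/(iter a.+1 P x) ea !eqxx /= -neq_ltn.
by apply/negP => /eqP/val_inj/eqP/amin; rewrite ltnn.
Qed.

Lemma layered_traject_path (n : nat) (G : rel 'I_n) (S : {set 'I_n}) (N : nat) (v : 'I_n)
    (lev : 'I_n -> nat) (P : 'I_n -> 'I_n) (x : 'I_n) (a : nat) :
  layered G S N v lev P -> symmetric G -> (lev x <= N)%N -> (a <= lev x)%N ->
  path G x (traject P (P x) a).
Proof.
move=> lay Gs; have [_ _ hP _] := lay; elim: a x => [|a IH] x //= xN ax.
have [||_ _ lP gP] := hP x (lev x).-1; [lia|lia|].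
by rewrite Gs gP /=; apply: IH; rewrite lP; lia.
Qed.

Lemma layered_traject_uniq (n : nat) (G : rel 'I_n) (S : {set 'I_n}) (N : nat) (v : 'I_n)
    (lev : 'I_n -> nat) (P : 'I_n -> 'I_n) (x : 'I_n) (a : nat) :
  layered G S N v lev P -> (lev x <= N)%N -> (a <= lev x)%N ->
  uniq (traject P (P x) a).
Proof.
move=> lay xN ax; rewrite -(map_inj_in_uniq (f := lev)).
  have -> : [seq lev u | u <- traject P (P x) a] = [seq (lev x - i.+1)%N | i <- iota 0 a].
    apply: (@eq_from_nth _ 0%N); rewrite !size_map size_traject ?size_iota // => i ia.
    rewrite (nth_map (P x)) ?size_traject // (nth_map 0%N) ?size_iota // nth_traject // nth_iota // add0n.
    by rewrite -iterSr (layered_iter lay) //; lia.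
  by rewrite map_inj_in_uniq ?iota_uniq // => i j; rewrite !mem_iota; lia.
move=> y z /trajectP[i ia ->] /trajectP[j ja ->].
rewrite -!iterSr !(layered_iter lay) //; try lia.
by move=> e; have -> : i = j by lia.
Qed.

(** Close the path through the tree: from its last vertex [h.+1] steps up to the common ancestor,
    then down to [x]. The tree vertices lie strictly below the levels of the path. The two branches
    are disjoint, since a common vertex would make the ancestors at height [h] equal, against
    [left_of]. *)
Lemma layered_cycle (n : nat) (G : rel 'I_n) (S : {set 'I_n}) (N : nat) (v : 'I_n)
    (lev : 'I_n -> nat) (P : 'I_n -> 'I_n) (x : 'I_n) (p : seq 'I_n) (h : nat) :
  layered G S N v lev P -> symmetric G -> (lev x <= N)%N ->
  path G x p -> uniq (x :: p) -> lev (last x p) = lev x ->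
  (forall u, u \in p -> (lev x <= lev u)%N) -> (h < lev x)%N -> left_of P h x (last x p) ->
  contains_copy (@cycle_graph (size p + 2 * h.+1)) G.
Proof.
move=> lay Gs xN pp up lx hp hx /andP[/eqP e1 l2]; set y := last x p in lx e1 l2.
pose s := (x :: p) ++ traject P (P y) h.+1 ++ rev (traject P (P x) h).
have ss : size s = (size p + 2 * h.+1)%N.
  by rewrite /s !size_cat size_rev !size_traject /=; lia.
rewrite -ss; apply: contains_cycle => //; last first.
  change (is_true (path G x
    (rcons (p ++ traject P (P y) h.+1 ++ rev (traject P (P x) h)) x))).
  rewrite !rcons_cat !cat_path pp -/y (layered_traject_path lay) ?lx // !andTb.
  rewrite -rev_cons -trajectS last_traject -e1.
  have ex : traject P x h.+1 = belast x (traject P (P x) h.+1).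
    apply: (@rcons_injl _ (iter h.+1 P x)).
    by rewrite -trajectSr trajectS lastI last_traject.
  have := layered_traject_path lay Gs xN hx.
  rewrite ex -(last_traject P x h.+1) rev_path.
  by rewrite (eq_path (e' := G)) // => a b; rewrite Gs.
have levy a : (a < h.+1)%N -> lev (iter a P (P y)) = (lev x - a.+1)%N.
  by move=> ah; rewrite -iterSr (layered_iter lay) lx //; lia.
have levx a : (a < h)%N -> lev (iter a P (P x)) = (lev x - a.+1)%N.
  by move=> ah; rewrite -iterSr (layered_iter lay) //; lia.
rewrite /s !cat_uniq up rev_uniq (layered_traject_uniq lay) ?lx //.
rewrite (layered_traject_uniq lay) //; last lia.
rewrite !andTb andbT; apply/andP; split.
  apply/negP => /hasP[u]; rewrite mem_cat mem_rev => hu; rewrite inE => uxp.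
  have lxu : (lev x <= lev u)%N by case/orP: uxp => [/eqP -> //|/hp].
  have : (lev u < lev x)%N.
    case/orP: hu => [|/trajectP[a ah ->]]; last by rewrite levx //; lia.
    by move=> /trajectP[a ah ->]; rewrite levy //; lia.
  by rewrite ltnNge lxu.
apply/negP => /hasP[u]; rewrite mem_rev => /trajectP[a ah ->].
move=> /trajectP[b bh e].
have ab : a = b by move: (congr1 lev e); rewrite levx // levy //; lia.
subst b; move: l2.
have -> : iter h P x = iter h P y.
  have -> : h = ((h - a.+1) + a.+1)%N by lia.
  by rewrite !iterD !iterSr e.
by rewrite ltnn.
Qed.

Definition exit_stage (T : finType) (E : nat -> {set T}) (J : nat) (u : T) : nat :=
  find (fun j => u \notin E j.+1) (iota 0 J).

Lemma exit_stageP (T : finType) (E : nat -> {set T}) (J : nat) (u : T) :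
  u \in E 0%N -> E J = set0 ->
  [/\ (exit_stage E J u < J)%N, u \in E (exit_stage E J u) & u \notin E (exit_stage E J u).+1].
Proof.
move=> u0 EJ; set j := exit_stage E J u.
have hs : has (fun j => u \notin E j.+1) (iota 0 J).
  case: J EJ @j => [|J] EJ j; first by rewrite EJ in_set0 in u0.
  by apply/hasP; exists J; rewrite ?mem_iota ?add0n ?leqnn // EJ in_set0.
have jJ : (j < J)%N by rewrite -[J](size_iota 0) -has_find.
split=> //; last by have := nth_find 0%N hs; rewrite -/j nth_iota.
case jE: j => [//|i].
have := @before_find _ 0%N (fun j => u \notin E j.+1) (iota 0 J) i.
rewrite -/(exit_stage E J u) -/j jE ltnS leqnn nth_iota ?add0n; last by lia.
by move=> /(_ isT)/negbFE.
Qed.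

(* Erdos-Faudree-Rousseau-Schelp: a left-to-right path with [2l+1-2(h+1)] edges inside a level whose
   vertices pairwise branch at height [h.+1] closes up to a [C_{2l+1}] through the tree. Hence for
   each [h] the relation [left_of P h] has bounded path length, and recording for every [h] the
   length of a longest such path colours the level. *)
Lemma odd_level_proper (n l i N : nat) (G : rel 'I_n) (S : {set 'I_n}) (v : 'I_n)
    (lev : 'I_n -> nat) (P : 'I_n -> 'I_n) :
  symmetric G -> irreflexive G -> H_free (@cycle_graph (2 * l + 1)) G ->
  layered G S N v lev P -> (i <= N)%N -> (i <= l)%N ->
  exists f : 'I_n -> {ffun 'I_l -> 'I_(2 * l).+2}, proper_on G [set u | lev u == i] f.
Proof.
move=> Gs Gi hf lay iN il; set X := [set u | lev u == i].
pose step h (E : {set 'I_n}) := [set u in E | [exists w in E, G u w && left_of P h u w]].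
(* The vertices of the level that start a left-to-right path with [j] edges; the exit stage of a
   vertex is thus the length of its longest such path. *)
pose E h j := iter j (step h) X.
have EX h j : E h j \subset X.
  elim: j => // j IH; apply: subset_trans IH; apply/subsetP => u.
  by rewrite /E /= inE => /andP[].
have pathE h j u : u \in E h j -> exists p, [/\ path G u p, size p = j,
    forall w, w \in p -> w \in X /\ left_of P h u w & uniq (u :: p)].
  elim: j u => [|j IH] u; first by exists [::].
  rewrite /E /= inE => /andP[uE /existsP[w /and3P[wE guw luw]]].
  have [p [p1 p2 p3 p4]] := IH w wE; exists (w :: p).
  have p5 z : z \in w :: p -> z \in X /\ left_of P h u z.
    rewrite inE => /orP[/eqP ->|/p3[zX lz]]; split=> //.
      exact: (subsetP (EX h j)).
    exact: left_of_trans luw lz.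
  split=> //; [by rewrite /= guw|by rewrite /= p2|].
  apply/andP; split; last exact: p4.
  by apply/negP => /p5[_]; rewrite left_of_irr.
have Elt h j j' : (j <= j')%N -> E h j' \subset E h j.
  move=> /subnK <-; elim: (j' - j)%N => // d IH; apply: subset_trans IH.
  by rewrite addSn; apply/subsetP => u; rewrite {1}/E /= inE => /andP[].
(* Stage [2l + 1 - 2(h + 1)] is already empty; [(2 * l).+2] serves all [h] at once, so that the exit
   stages share one finite type. *)
have E0 h : (h < i)%N -> E h (2 * l).+2 = set0.
  have sJ : (2 * l + 1 - 2 * h.+1 <= (2 * l).+2)%N by lia.
  move=> hi; apply/eqP; rewrite -subset0; apply/subsetP => u /(subsetP (Elt h _ _ sJ)) uE.
  exfalso; apply: hf.
  have uX : lev u = i by have := subsetP (EX _ _) _ uE; rewrite inE => /eqP.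
  have [p [p1 p2 p3 p4]] := pathE _ _ _ uE.
  have lp : last u p \in p.
    by case: p p2 {p1 p3 p4} => [|a p] //= hp; [lia|rewrite mem_last].
  have [lX ll] := p3 _ lp.
  have -> : (2 * l + 1 = size p + 2 * h.+1)%N by rewrite p2; lia.
  apply: (layered_cycle (x := u) lay) => //; rewrite ?uX //.
    by move: lX; rewrite inE => /eqP.
  by move=> w /p3[]; rewrite inE => /eqP ->.
exists (fun u => [ffun h : 'I_l => inord (exit_stage (E h) (2 * l).+2 u)]).
suff key u w h : u \in X -> w \in X -> G u w -> (h < i)%N -> left_of P h u w ->
    exit_stage (E h) (2 * l).+2 u <> exit_stage (E h) (2 * l).+2 w.
  move=> u w uX wX guw; apply/negP => /eqP euw.
  have lu : lev u = i by move: uX; rewrite inE => /eqP.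
  have lw : lev w = i by move: wX; rewrite inE => /eqP.
  have uw : u != w by apply: contraTneq guw => ->; rewrite Gi.
  have [||h hi hb] := branch_height lay _ _ uw; rewrite ?lu ?lw //.
  rewrite lu in hi; have hl : (h < l)%N by apply: leq_trans hi il.
  have := congr1 (fun g : {ffun 'I_l -> 'I_(2 * l).+2} => val (g (Ordinal hl))) euw.
  rewrite /= !ffunE.
  have [u1 _ _] := exit_stageP (E := E h) uX (E0 h hi).
  have [w1 _ _] := exit_stageP (E := E h) wX (E0 h hi).
  rewrite !inordK // => e; case/orP: hb => hb.
    exact: key uX wX guw hi hb e.
  by apply: (key w u h) => //; rewrite Gs.
move=> uX wX guw hi luw e.
have [_ u2 u3] := exit_stageP (E := E h) uX (E0 h hi).
have [_ w2 _] := exit_stageP (E := E h) wX (E0 h hi).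
case/negP: u3; rewrite /E iterS -/(E h _) inE u2 /=.
by apply/existsP; exists w; rewrite guw luw e w2.
Qed.

Lemma stable_setU (n : nat) (G : rel 'I_n) (I J : {set 'I_n}) :
  symmetric G -> stable G I -> stable G J ->
  (forall u w, u \in I -> w \in J -> ~~ G u w) -> stable G (I :|: J).
Proof.
move=> Gs /stableP sI /stableP sJ h; apply/stableP => u w; rewrite !in_setU.
move=> /orP[uI|uJ] /orP[wI|wJ]; [exact: sI|exact: h|by rewrite Gs; apply: h|exact: sJ].
Qed.

(** The number of colours that [odd_level_proper] spends on a level. *)
Definition odd_const (l : nat) : nat := ((2 * l).+2 ^ l)%N.

Lemma sum_setU_le (R : realType) (T : finType) (A B : {set T}) (w : T -> R) :
  (forall v, 0 <= w v) ->
  \sum_(v in A :|: B) w v <= \sum_(v in A) w v + \sum_(v in B) w v.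
Proof.
move=> w0; rewrite (big_setID A) /= setUK setDUl setDv set0U lerD2l.
by rewrite [leRHS](big_setID A) /= lerDr sumr_ge0.
Qed.

(* The weight of consecutive breadth-first levels cannot grow by a factor [t] at each of [l.+1] steps
   from a heaviest root, so some level [i <= l] carries a fraction [1 / (t + 2)] of the weight of its
   neighbourhood. *)
Lemma frac_chi_odd_cycle_free (R : realType) (n t l : nat) (G : rel 'I_n) (S : {set 'I_n}) :
  symmetric G -> irreflexive G -> (0 < t)%N -> H_free (@cycle_graph (2 * l + 1)) G ->
  (#|S| <= t ^ l.+1)%N -> frac_chi_le G S ((odd_const l * (t + 2))%:R : R).
Proof.
move=> Gs Gi t0 hf hS w w0; set q : R := _%:R.
have [j] := ubnP #|S|; elim: j S hS => // j IH S hS; rewrite ltnS => Sj.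
have [->|/set0Pn[v1 v1S]] := eqVneq S set0.
  exists set0; split; rewrite ?sub0set ?big_set0 ?mulr0 //.
  by apply/stableP => u v; rewrite in_set0.
pose v := [arg max_(u > v1 in S) w u]%O.
have [vS vm] : v \in S /\ forall u, u \in S -> w u <= w v.
  by rewrite /v; case: arg_maxP => // i iS h; split.
have [lev [P lay]] := bfs_layered G l.+1 vS.
have [l1 l2 l3 l4] := lay.
pose X i := [set u in S | lev u == i].
pose W i := \sum_(u in X i) w u.
have W0 i : 0 <= W i by apply: sumr_ge0.
have XS i : X i \subset S by apply/subsetP => u; rewrite inE => /andP[].
have t1 : 1 <= t%:R :> R by rewrite ler1n.
have WX i : X i = set0 -> W i = 0 by rewrite /W => ->; rewrite big_set0.
have X0 : v \in X 0%N by rewrite inE vS l1 eqxx.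
(* The least [i] that satisfies the second condition: the step before it grew by more than [t >= 1],
   which gives [W i.-1 <= W i]. If there is none, level [l.+1] would outweigh [|S|] times the
   heaviest vertex. *)
have [i [il hi1 hi2 Xi]] : exists i, [/\ (i <= l)%N, W i.+1 <= t%:R * W i,
    W i.-1 <= W i & X i != set0].
  have [/existsP[i0 hi0]|/existsPn no] := boolP [exists i : 'I_l.+1, W i.+1 <= t%:R * W i].
    have ex : exists i, (i <= l)%N && (W i.+1 <= t%:R * W i).
      by exists i0; rewrite -ltnS ltn_ord.
    case: (ex_minnP ex) => -[|i] /andP[il hi] imin; first by exists 0%N; split=> //; apply/set0Pn; exists v.
    exists i.+1; have := imin i; case hi' : (_ <= _) => /=; last first.
      move=> _; move/negbT: hi'; rewrite -ltNge => lt.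
      have le : W i <= t%:R * W i by rewrite ler_peMl.
      split=> //; first by apply: le_trans le (ltW lt).
      by apply/eqP => /WX e; move: lt; rewrite e ltNge (le_trans (W0 i) le).
    by rewrite (ltnW il) => /(_ isT); rewrite ltnn.
  have grow a : (a <= l)%N -> t%:R ^+ a * W 0%N <= W a.
    elim: a => [|a IHa] al; first by rewrite mul1r.
    have := no (Ordinal (ltnW (al : (a.+1 < l.+1)%N))); rewrite -ltNge /= => /ltW; apply: le_trans.
    by rewrite exprS -mulrA ler_wpM2l //; apply: IHa; apply: ltnW.
  have := no ord_max; rewrite -ltNge /= => lt; exfalso.
  have : t%:R ^+ l.+1 * w v < W l.+1.
    apply: le_lt_trans lt; rewrite exprS -mulrA ler_wpM2l //.
    apply: le_trans (grow l (leqnn l)); rewrite ler_wpM2l ?exprn_ge0 //.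
    by rewrite /W (bigD1 v) //= lerDl sumr_ge0.
  apply/negP; rewrite -leNgt.
  apply: (@le_trans _ _ (\sum_(u in S) w u)).
    by rewrite [leRHS](big_setID (X l.+1)) /= (setIidPr (XS _)) lerDl sumr_ge0.
  apply: (@le_trans _ _ (\sum_(u in S) w v)); first exact: ler_sum.
  by rewrite sumr_const -(mulr_natl (w v)) ler_wpM2r // -natrX ler_nat.
have [f pf] := odd_level_proper Gs Gi hf lay (leqW il) il.
have pX : proper_on G (X i) f.
  by move=> a b; rewrite [a \in _]inE [b \in _]inE => /andP[_ ai] /andP[_ bi]; apply: pf; rewrite inE.
have [I [IX stI hI]] := frac_chi_le_proper pX w0.
rewrite card_ffun !card_ord -/(odd_const l) -/(W i) in hI.
(* No vertex of [S] outside [Y] is adjacent to level [i], so [I] can be joined to a stable set of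
   the rest. [Y] weighs at most [(t + 2) * W i], and [I] at least [W i / odd_const l]. *)
pose Y := X i :|: (X i.+1 :|: X i.-1).
have YS : Y \subset S by rewrite !subUset !XS.
have IY : I \subset Y by apply: subset_trans IX _; apply: subsetUl.
have [||J [JS stJ hJ]] := IH (S :\: Y).
- by apply: leq_trans hS; rewrite subset_leq_card // subsetDl.
- apply: leq_trans Sj; apply: proper_card; apply/properP; split; first exact: subsetDl.
  have /set0Pn[u uX] := Xi; exists u; first exact: (subsetP (XS i)).
  by rewrite !inE in uX *; rewrite uX.
exists (I :|: J); split.
- by rewrite subUset (subset_trans IY YS) (subset_trans JS) ?subsetDl.
- apply: stable_setU => // u x /(subsetP IX); rewrite inE => /andP[uS /eqP lu].
  move=> /(subsetP JS); rewrite !inE => /andP[hx xS]; rewrite xS /= in hx.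
  apply/negP => gux.
  have lx : (lev x <= i.+1)%N by rewrite -lu; apply: l4; rewrite ?lu.
  have [lxi|lxi] := leqP i (lev x).
    by move: hx; rewrite !negb_or => /and3P[h1 h2 _]; clear -h1 h2 lx lxi; lia.
  have : (lev u <= (lev x).+1)%N.
    by apply: l4 => //; [apply: ltn_trans lxi _|rewrite Gs].
  by move: hx; rewrite !negb_or => /and3P[_ _ h3] h4; clear -h3 h4 lu lxi; lia.
have dJI : [disjoint J & I].
  rewrite -setI_eq0; apply/eqP/setP => u; rewrite in_set0 inE; apply/negP => /andP[uJ uI].
  by have := subsetP JS u uJ; rewrite inE (subsetP IY u uI).
have -> : \sum_(u in I :|: J) w u = \sum_(u in I) w u + \sum_(u in J) w u.
  by rewrite (big_setID I) /= setUK setDUl setDv set0U (setDidPl _).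
rewrite mulrDr (big_setID Y) /= (setIidPr YS) lerD //.
apply: (@le_trans _ _ ((t + 2)%:R * W i)).
  apply: le_trans (sum_setU_le _ _ w0) _.
  apply: le_trans (lerD (lexx _) (sum_setU_le _ _ w0)) _.
  by rewrite -!/(W _) natrD; lra.
by rewrite /q natrM -[leRHS]mulrA [leRHS]mulrCA ler_wpM2l.
Qed.

(** * Even cycles: edges between consecutive levels, and degeneracy *)

(** For [even_level_edges]. The first summand counts deletions at an end of degree at most [l]: over
    [l] heights and [l.+1] rounds, at most [l] edges for each vertex of level [i]. The second is the
    number of vectors of deletion rounds, each met by at most one remaining edge at a given vertex
    of level [i.+1]. *)
Definition even_const (l : nat) : nat := (l * l.+1 * l + l.+1 ^ l)%N.

(* The analogue of [odd_level_proper] for paths alternating between two consecutive levels. For each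
   height [h], edges are deleted in rounds, either because their lower end has degree at most [l], or
   because they have no partner to the right at their upper end; edges surviving enough rounds start
   a long path. The first reason deletes few edges; two edges with the same upper end that are
   deleted for the second reason in the same round for every [h] coincide. *)
Lemma even_level_edges (n l i N : nat) (G : rel 'I_n) (S : {set 'I_n}) (v : 'I_n)
    (lev : 'I_n -> nat) (P : 'I_n -> 'I_n) :
  symmetric G -> H_free (@cycle_graph (2 * l)) G ->
  layered G S N v lev P -> (i <= N)%N -> (i < l)%N ->
  (#|[set e : 'I_n * 'I_n | [&& lev e.1 == i, lev e.2 == i.+1 & G e.1 e.2]]| <=
   even_const l * (#|[set u | lev u == i]| + #|[set u | lev u == i.+1]|))%N.
Proof.
move=> Gs hf lay iN il.
set E0 := [set e : 'I_n * 'I_n | _]; set X := [set u | lev u == i]; set Y := [set u | _].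
pose deg (E : {set 'I_n * 'I_n}) x := #|[set y | (x, y) \in E]|.
(* [low] keeps an edge when its end on level [i] has degree above [l]; the edges of low degree are
   those outside it. *)
pose low (E : {set 'I_n * 'I_n}) := [set e in E | (l < deg E e.1)%N].
pose step h (E : {set 'I_n * 'I_n}) :=
  [set e in low E | [exists x, ((x, e.2) \in low E) && left_of P h e.1 x]].
pose E h j := iter j (step h) E0.
have Elow h j : E h j.+1 \subset low (E h j).
  by apply/subsetP => e; rewrite /E iterS inE => /andP[].
have lowE F : low F \subset F by apply/subsetP => e; rewrite inE => /andP[].
have EE0 h j : E h j \subset E0.
  elim: j => // j; apply: subset_trans; exact: subset_trans (Elow h j) (lowE _).
have E0E x y : (x, y) \in E0 -> [/\ lev x = i, lev y = i.+1 & G x y].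
  by rewrite inE /= => /and3P[/eqP -> /eqP ->].
(* [Z] lists the vertices of level [i.+1] to be avoided. As [x'] has more than [l] surviving edges,
   one of them ends outside [y :: Z]. On level [i] the relation [left_of] keeps the vertices
   distinct. *)
have pathE h j (Z : seq 'I_n) x y : (x, y) \in E h j -> y \notin Z -> (size Z + j <= l)%N ->
    exists p, [/\ path G x p, size p = (2 * j)%N,
      forall u, u \in p -> (lev u = i /\ left_of P h x u) \/ (lev u = i.+1 /\ u \notin Z),
      uniq (x :: p) & lev (last x p) = i].
  elim: j Z x y => [|j IH] Z x y xyE yZ sZ.
    have [] := E0E x y xyE; move=> lx _ _; by exists [::].
  move: (xyE); rewrite /E iterS -/(E h j) inE => /andP[xyl /existsP[x' /andP[x'yl lx]]] /=.
  have [lvx lvy gxy] := E0E x y (subsetP (EE0 h j.+1) _ xyE).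
  have [lvx' _ gx'y] := E0E x' y (subsetP (EE0 h j) _ (subsetP (lowE _) _ x'yl)).
  have [y' x'y' y'Z] : exists2 y', (x', y') \in E h j & y' \notin y :: Z.
    have /subsetPn[y'] : ~~ ([set y' | (x', y') \in E h j] \subset y :: Z).
      apply/negP => /subset_leq_card sub; move: x'yl; rewrite inE /= => /andP[_].
      rewrite ltnNge => /negP; apply; rewrite /deg (leq_trans sub) //.
      by apply: leq_trans (card_size _) _; move: sZ; rewrite addnS; apply: leq_trans; rewrite ltnS leq_addr.
    by rewrite inE => ? ?; exists y'.
  have [|p [p1 p2 p3 p4 p5]] := IH (y :: Z) x' y' x'y' y'Z; first by rewrite /= addSnnS.
  exists [:: y, x' & p].
  have q3 u : u \in x' :: p -> (lev u = i /\ left_of P h x u) \/ (lev u = i.+1 /\ u \notin y :: Z).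
    rewrite inE => /orP[/eqP ->|/p3[[lu lxu]|[lu uZ]]]; [by left| |by right].
    by left; split=> //; apply: left_of_trans lxu.
  have q3' u : u \in [:: y, x' & p] ->
      (lev u = i /\ left_of P h x u) \/ (lev u = i.+1 /\ u \notin Z).
    rewrite inE => /orP[/eqP ->|/q3[]]; [by right|by left|].
    by rewrite inE negb_or => -[? /andP[_ ?]]; right.
  split=> //.
  - by rewrite /= gxy Gs gx'y.
  - by rewrite /= p2 mulnS.
  - apply/andP; split.
      apply/negP => /q3'[[_]|[lu _]]; first by rewrite left_of_irr.
      by move: lu; rewrite lvx => /n_Sn.
    apply/andP; split=> //; apply/negP => /q3[[lu _]|[_]]; first by move: lu; rewrite lvy => /esym/n_Sn.
    by rewrite inE eqxx.
have Elt h j j' : (j <= j')%N -> E h j' \subset E h j.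
  move=> /subnK <-; elim: (j' - j)%N => // d; rewrite addSn; apply: subset_trans.
  exact: subset_trans (Elow _ _) (lowE _).
(* An edge surviving [l - h.+1] rounds would start a path with [2(l - h - 1)] edges, which two
   branches of length [h + 1] close to a cycle of length [2l]. *)
have EJ h : (h < i)%N -> E h l.+1 = set0.
  move=> hi; have sJ : (l - h.+1 <= l.+1)%N by lia.
  apply/eqP; rewrite -subset0; apply/subsetP => -[x y] /(subsetP (Elt h _ _ sJ)) xyE.
  exfalso; apply: hf.
  have [lx _ _] := E0E x y (subsetP (EE0 _ _) _ xyE).
  have [//|/=|p [p1 p2 p3 p4 p5]] := @pathE h (l - h.+1)%N [::] x y xyE; first by lia.
  have lp : last x p \in p.
    by case: p p2 {p1 p3 p4 p5} => [|a p] //= hp; [lia|rewrite mem_last].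
  have -> : (2 * l = size p + 2 * h.+1)%N by rewrite p2; lia.
  apply: (layered_cycle (x := x) lay) => //; rewrite ?lx //.
    by move=> u /p3[[-> _]|[-> _]].
  by have [[_ ->]|[]] := p3 _ lp; rewrite // p5; lia.
pose ex (h : 'I_l) := exit_stage (E h) l.+1.
pose Low := [set e in E0 | [exists h : 'I_l, (h < i)%N && (e \notin low (E h (ex h e)))]].
pose key (e : 'I_n * 'I_n) : {ffun 'I_l -> 'I_l.+1} := [ffun h => inord (ex h e)].
have cLow : (#|Low| <= l * l.+1 * l * #|X|)%N.
  pose D (a : 'I_l * 'I_l.+1 * 'I_n) : {set 'I_n * 'I_n} :=
    [set e in E a.1.1 a.1.2 | (e.1 == a.2) && (deg (E a.1.1 a.1.2) a.2 <= l)%N].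
  have sub : Low \subset \bigcup_(a in setX [set: 'I_l * 'I_l.+1] X) D a.
    apply/subsetP => e; rewrite inE => /andP[eE0 /existsP[h /andP[hi he]]].
    have [e1 e2 _] := exit_stageP eE0 (EJ h hi).
    apply/bigcupP; exists (h, Ordinal e1, e.1) => /=.
      by move: eE0; rewrite !inE => /and3P[].
    by move: he; rewrite !inE /= eqxx e2 /= -leqNgt.
  have cD a : (#|D a| <= l)%N.
    have [da|da] := leqP (deg (E a.1.1 a.1.2) a.2) l; last first.
      have -> : D a = set0 by apply/setP => e; rewrite !inE leqNgt da andbF andbF.
      by rewrite cards0.
    apply: leq_trans da; rewrite /deg -[leqRHS](card_imset _ (f := pair a.2)); last by move=> ? ? [].
    apply: subset_leq_card; apply/subsetP => -[x y]; rewrite inE /= => /andP[xy /andP[/eqP xa _]].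
    by apply/imsetP; exists y; rewrite ?inE -?xa.
  apply: leq_trans (subset_leq_card sub) _.
  apply: (@leq_trans (\sum_(a in setX [set: 'I_l * 'I_l.+1] X) l)).
    apply: (big_ind2 (fun (A : {set _}) m => #|A| <= m)%N) => //; first by rewrite cards0.
    move=> A1 m1 A2 m2 h1 h2; apply: leq_trans (leq_add h1 h2).
    by rewrite cardsU leq_subr.
  by rewrite sum_nat_const cardsX cardsT card_prod !card_ord; nia.
have cRest : (#|E0 :\: Low| <= l.+1 ^ l * #|Y|)%N.
  have kinj x x' y : (x, y) \in E0 :\: Low -> (x', y) \in E0 :\: Low ->
      key (x, y) = key (x', y) -> ~~ [exists h : 'I_l, (h < i)%N && left_of P h x x'].
    rewrite !in_setD => /andP[nx xE] /andP[nx' x'E] ek; apply/existsPn => h; apply/negP.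
    move=> /andP[hi hxx'].
    have notlow z : (z, y) \notin Low -> (z, y) \in E0 -> (z, y) \in low (E h (ex h (z, y))).
      move=> zL zE; move: zL; rewrite inE zE /= => /existsPn/(_ h).
      by rewrite hi /= negbK.
    have [j1 _ /negP j3] := exit_stageP xE (EJ h hi).
    have [j1' _ _] := exit_stageP x'E (EJ h hi).
    have e : ex h (x, y) = ex h (x', y).
      have := congr1 (fun g : {ffun 'I_l -> 'I_l.+1} => val (g h)) ek.
      by rewrite /= !ffunE !inordK.
    apply: j3; rewrite /E iterS -/(E h _) inE (notlow _ nx xE) /=.
    by apply/existsP; exists x'; rewrite hxx' andbT -/(ex h (x, y)) e notlow.
  have inj : {in E0 :\: Low &, injective (fun e => (key e, e.2))}.
    move=> [x y] [x' y'] xE x'E [ek ey]; rewrite /= in ey; subst y'.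
    have [->//|xx'] := eqVneq x x'; exfalso.
    have [lx _ _] := E0E x y (subsetP (subsetDl _ _) _ xE).
    have [lx' _ _] := E0E x' y (subsetP (subsetDl _ _) _ x'E).
    have [||h hi /orP[] hb] := branch_height lay _ _ xx'; rewrite ?lx ?lx' //.
      have hl : (h < l)%N by apply: ltn_trans il; rewrite -lx.
      have /existsPn/(_ (Ordinal hl)) := kinj x x' y xE x'E ek.
      by rewrite /= hb -lx hi.
    have hl : (h < l)%N by apply: ltn_trans il; rewrite -lx.
    have /existsPn/(_ (Ordinal hl)) := kinj x' x y x'E xE (esym ek).
    by rewrite /= hb -lx hi.
  rewrite -(card_in_imset inj).
  apply: (@leq_trans #|setX [set: {ffun 'I_l -> 'I_l.+1}] Y|).
    apply: subset_leq_card; apply/subsetP => p /imsetP[[x y] xyE ->].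
    rewrite !inE /=; have [_ -> _] := E0E x y (subsetP (subsetDl _ _) _ xyE).
    by rewrite eqxx.
  by rewrite cardsX cardsT card_ffun !card_ord.
have := cardsID Low E0.
have -> : E0 :&: Low = Low by apply/setIidPr/subsetP => e; rewrite inE => /andP[].
rewrite /even_const; nia.
Qed.

(** In a maximum cut no vertex gains by changing sides. *)
Lemma max_cut (n : nat) (G : rel 'I_n) (S : {set 'I_n}) :
  symmetric G -> irreflexive G ->
  exists A : {set 'I_n}, forall u, u \in S ->
    (#|[set w in S | G u w]| <= 2 * #|[set w in S | G u w && ((u \in A) != (w \in A))]|)%N.
Proof.
move=> Gs Gi; pose c (A : {set 'I_n}) u w := G u w && ((u \in A) != (w \in A)).
pose f A := (\sum_(u in S) \sum_(w in S) c A u w)%N.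
pose A := [arg max_(A > set0) f A].
have fA B : (f B <= f A)%N by rewrite /A; case: arg_maxnP => // i _; apply.
exists A => u uS; rewrite leqNgt; apply/negP => lt.
pose B := [set w | (w \in A) (+) (w == u)].
have cs D x y : c D x y = c D y x by rewrite /c Gs eq_sym.
have cd D : c D u u = false by rewrite /c Gi.
have fE D : f D = (2 * \sum_(w in S) c D u w + \sum_(x in S | x != u) \sum_(y in S | y != u) c D x y)%N.
  rewrite /f (bigD1 u) //= mul2n -addnn -addnA; congr addn.
  rewrite [X in _ = (X + _)%N](bigD1 u) //= cd add0n -big_split /=.
  by apply: eq_bigr => x /andP[xS xu]; rewrite (bigD1 u) //= cs.
have cardE' (p : pred 'I_n) : #|[set w in S | p w]| = (\sum_(w in S) p w)%N.
  by rewrite -sum1dep_card big_mkcondr /=; apply: eq_bigr => w _; case: (p w).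
have cB : (\sum_(w in S) c B u w + \sum_(w in S) c A u w = \sum_(w in S) G u w)%N.
  rewrite -big_split; apply: eq_bigr => w _; rewrite /c /= !inE eqxx.
  case: (eqVneq w u) => [->|wu]; first by rewrite Gi.
  by case: (G u w); case: (u \in A); case: (w \in A).
have oth : (\sum_(x in S | x != u) \sum_(y in S | y != u) c B x y =
            \sum_(x in S | x != u) \sum_(y in S | y != u) c A x y)%N.
  apply: eq_bigr => x /andP[_ xu]; apply: eq_bigr => y /andP[_ yu].
  by rewrite /c !inE (negbTE xu) (negbTE yu) !addbF.
have := fA B; rewrite !fE oth.
move: lt; rewrite !cardE' -/(c A u); move: cB.
set a := (\sum_(w in S) c A u w)%N; set b := (\sum_(w in S) c B u w)%N.
by set d := (\sum_(w in S) G u w)%N; lia.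
Qed.

Lemma even_const_gt0 (l : nat) : (0 < even_const l)%N.
Proof. by rewrite /even_const addn_gt0 expn_gt0 orbT. Qed.

(** Let [C = even_const l] and let [x_i] be the size of level [i]. Bipartiteness excludes edges
    inside a level, so [d x_i <= C (x_(i-1) + 2 x_i + x_(i+1))]. With [x_(i-1) <= x_i] and
    [6 C <= d], half of the left side remains: [d x_i <= 2 C x_(i+1)]. *)
Lemma even_cycle_free_card (n l d : nat) (G : rel 'I_n) (S A : {set 'I_n}) :
  symmetric G -> H_free (@cycle_graph (2 * l)) G -> S != set0 -> (0 < l)%N ->
  (forall u w, G u w -> (u \in A) != (w \in A)) ->
  (6 * even_const l <= d)%N -> (forall u, u \in S -> (d <= #|[set w in S | G u w]|)%N) ->
  (d ^ l <= (2 * even_const l) ^ l * #|S|)%N.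
Proof.
move=> Gs hf /set0Pn[v vS] l0 bip dC hd; set C := even_const l in dC *.
have C0 : (0 < C)%N := even_const_gt0 l.
have [lev [P lay]] := bfs_layered G l vS; have [l1 l2 l3 l4] := lay.
pose X i := [set u | lev u == i].
have XS i : (i <= l)%N -> X i \subset S.
  case: i => [|i] il; apply/subsetP => u; rewrite inE => /eqP lu.
    by rewrite (l2 u lu).
  by have [] := l3 u i lu il.
have par u : (lev u <= l)%N -> (u \in A) = (v \in A) (+) odd (lev u).
  move: {2}(lev u) (erefl (lev u)) => i; elim: i u => [|i IH] u lu ul.
    by rewrite (l2 u lu) l1 addbF.
  have [_ _ lP gP] := l3 u i lu ltac:(by rewrite lu in ul).
  have := bip _ _ gP; rewrite (IH (P u)) ?lP; [|by []|by rewrite lu in ul; apply: ltnW].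
  by rewrite lu /=; case: (v \in A); case: (odd i); case: (u \in A).
pose E i := [set e : 'I_n * 'I_n | [&& lev e.1 == i, lev e.2 == i.+1 & G e.1 e.2]].
have hE i : (i < l)%N -> (#|E i| <= C * (#|X i| + #|X i.+1|))%N.
  by move=> il; apply: (even_level_edges Gs hf lay) => //; apply: ltnW.
have degE i : (0 < i < l)%N -> (d * #|X i| <= #|E i.-1| + #|E i|)%N.
  move=> /andP[i0 il].
  apply: (@leq_trans #|[set e : 'I_n * 'I_n | [&& lev e.1 == i, e.2 \in S & G e.1 e.2]]|).
    rewrite -[leqRHS]sum1_card (eq_bigl (fun e : 'I_n * 'I_n => (e.1 \in X i) && ((e.2 \in S) && G e.1 e.2))); last first.
      by move=> e; rewrite !inE.
    rewrite -(pair_big_dep (fun x => x \in X i) (fun x y => (y \in S) && G x y) (fun _ _ => 1%N)) /=.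
    rewrite mulnC -sum_nat_const; apply: leq_sum => x xX.
    by have := hd x (subsetP (XS i (ltnW il)) x xX); rewrite -sum1dep_card.
  pose sw (e : 'I_n * 'I_n) := (e.2, e.1).
  have sub : [set e : 'I_n * 'I_n | [&& lev e.1 == i, e.2 \in S & G e.1 e.2]] \subset
      (sw @: E i.-1) :|: E i.
    apply/subsetP => -[x y]; rewrite inE /= => /and3P[/eqP lx yS gxy].
    have xS : x \in S by apply: (subsetP (XS i (ltnW il))); rewrite inE lx.
    have ly : (lev y <= i.+1)%N by rewrite -lx; apply: l4; rewrite ?lx.
    have ly' : (i <= (lev y).+1)%N.
      have [|] := leqP l (lev y); first by lia.
      by move=> h; rewrite -lx; apply: l4 => //; rewrite Gs.
    have lyn : lev y != i.
      apply/eqP => e; have := bip _ _ gxy; rewrite (par x) ?(par y) ?lx ?e ?(ltnW il) //.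
      by rewrite eqxx.
    rewrite inE; have [e|ne] := eqVneq (lev y) i.+1.
      by rewrite [X in _ || X]inE /= lx e gxy !eqxx orbT.
    have ly2 : lev y = i.-1 by lia.
    apply/orP; left; apply/imsetP; exists (y, x) => //.
    by rewrite inE /= ly2 lx prednK // Gs gxy !eqxx.
  apply: leq_trans (subset_leq_card sub) _; apply: leq_trans (leq_card_setU _ _) _.
  by rewrite leq_add2r leq_imset_card.
clearbody C; have X0 : X 0%N = [set v].
  by apply/setP => u; rewrite !inE; apply/eqP/eqP => [/l2|->].
have base : (d <= #|X 1%N|)%N.
  apply: leq_trans (hd v vS) _; apply: subset_leq_card; apply/subsetP => w.
  rewrite !inE => /andP[wS gvw]; have := l4 v w vS wS; rewrite l1 => /(_ l0 gvw).
  rewrite leq_eqVlt ltnS leqn0 => /orP[//|/eqP/l2 wv].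
  by have := bip _ _ gvw; rewrite wv eqxx.
have grow i : (i < l)%N -> (#|X i| <= #|X i.+1|)%N /\ (d * #|X i| <= 2 * C * #|X i.+1|)%N.
  elim: i => [|i IH] il; first by rewrite X0 cards1; nia.
  have [IH1 _] := IH (ltnW il).
  have h1 := hE i (ltnW il); have h2 := hE i.+1 il; have := degE i.+1; rewrite /= il => /(_ isT) h3.
  have p1 : (C * #|X i| <= C * #|X i.+1|)%N by rewrite leq_mul2l IH1 orbT.
  have p2 : (6 * C * #|X i.+1| <= d * #|X i.+1|)%N by rewrite leq_mul2r dC orbT.
  have q : (d * #|X i.+1| <= 2 * C * #|X i.+2|)%N.
    move: h1 h2 h3 p1 p2; rewrite !mulnDr -!mulnA.
    move: #|E i| #|E i.+1| (C * #|X i|)%N (C * #|X i.+1|)%N (C * #|X i.+2|)%N (d * #|X i.+1|)%N.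
    by clear=> *; lia.
  split=> //; rewrite -(leq_pmul2l C0); move: p2 q; rewrite -!mulnA.
  by move: (C * #|X i.+1|)%N (C * #|X i.+2|)%N (d * #|X i.+1|)%N; clear=> *; lia.
have fin i : (i <= l)%N -> (d ^ i <= (2 * C) ^ i * #|X i|)%N.
  elim: i => [|i IH] il; first by rewrite X0 cards1.
  have [_ h] := grow i il; have IH' := IH (ltnW il).
  rewrite !expnS; apply: (@leq_trans (d * ((2 * C) ^ i * #|X i|))).
    by rewrite leq_mul2l IH' orbT.
  have -> : (d * ((2 * C) ^ i * #|X i|) = (2 * C) ^ i * (d * #|X i|))%N by ring.
  have -> : (2 * C * (2 * C) ^ i * #|X i.+1| = (2 * C) ^ i * (2 * C * #|X i.+1|))%N by ring.
  by rewrite leq_mul2l h orbT.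
apply: leq_trans (fin l (leqnn l)) _.
by rewrite leq_mul2l subset_leq_card ?orbT ?XS.
Qed.

(** Otherwise some [S'] has minimum degree at least [k]. A maximum cut keeps half of each degree, so
    the constants 6 and 2 of [even_cycle_free_card] become 12 and 4. *)
Lemma even_cycle_free_colourable (n l k : nat) (C : finType) (c0 : C) (G : rel 'I_n)
    (L : 'I_n -> {set C}) (S : {set 'I_n}) :
  symmetric G -> irreflexive G -> H_free (@cycle_graph (2 * l)) G -> (0 < l)%N ->
  (12 * even_const l <= k)%N -> (forall v, v \in S -> #|L v| = k) ->
  ((4 * even_const l) ^ l * #|S| < k ^ l)%N -> colourable_on G L S.
Proof.
move=> Gs Gi hf l0 kC hL small.
apply: (@colourable_degenerate _ k _ c0) => // [v vS|S' sub Sn0]; first by rewrite hL.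
have [/existsP[v /andP[vS hv]]|/existsPn no] :=
  boolP [exists v, (v \in S') && (#|[set u in S' | G v u]| < k)%N]; first by exists v.
have {}no u : u \in S' -> (k <= #|[set w in S' | G u w]|)%N.
  by move=> uS; have := no u; rewrite uS /= -leqNgt.
have [A hA] := max_cut S' Gs Gi; exfalso.
pose H : rel 'I_n := fun u w => G u w && ((u \in A) != (w \in A)).
have Hs : symmetric H by move=> u w; rewrite /H Gs eq_sym.
have Hf : H_free (@cycle_graph (2 * l)) H.
  by move=> [g [g1 g2]]; apply: hf; exists g; split=> // i j /g2/andP[].
have hk : (k <= 2 * uphalf k)%N by lia.
have bip u w : H u w -> (u \in A) != (w \in A) by case/andP.
have dC : (6 * even_const l <= uphalf k)%N by clear -kC hk; lia.
have dH u : u \in S' -> (uphalf k <= #|[set w in S' | H u w]|)%N.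
  by move=> uS; rewrite leq_uphalf_double -mul2n (leq_trans (no u uS)) // hA.
have := even_cycle_free_card Hs Hf Sn0 l0 bip dC dH; apply/negP; rewrite -ltnNge.
have e : ((4 * even_const l) ^ l = 2 ^ l * (2 * even_const l) ^ l)%N.
  by rewrite -expnMn mulnA.
have h : (k ^ l <= 2 ^ l * uphalf k ^ l)%N by rewrite -expnMn leq_exp2r.
have p2 : (0 < 2 ^ l)%N by rewrite expn_gt0.
rewrite -(ltn_pmul2l p2); apply: leq_ltn_trans (leq_trans small h).
by rewrite e -mulnA leq_mul2l leq_mul2l subset_leq_card ?orbT.
Qed.

(** * Random lists *)

Local Notation lists n m := {ffun 'I_n -> {set 'I_m}}.

Lemma card_bigcup_le (T I : finType) (P : pred I) (F : I -> {set T}) :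
  (#|\bigcup_(i | P i) F i| <= \sum_(i | P i) #|F i|)%N.
Proof.
apply: (big_ind2 (fun (A : {set T}) m => #|A| <= m)%N) => //; first by rewrite cards0.
move=> A1 m1 A2 m2 h1 h2; apply: leq_trans (leq_add h1 h2).
by rewrite cardsU leq_subr.
Qed.

Lemma card_lists (n m : nat) (F : 'I_n -> {set {set 'I_m}}) :
  #|[set L : lists n m | [forall v, L v \in F v]]| = (\prod_v #|F v|)%N.
Proof.
have -> : (\prod_v #|F v|)%N = #|family (fun v => mem (F v))|.
  by rewrite card_family foldrE big_map big_enum.
by apply: eq_card => L; rewrite inE; apply/forallP/familyP => h v; apply: h.
Qed.

Lemma card_lists_split (n m a b : nat) (X : {set 'I_n}) (F : 'I_n -> {set {set 'I_m}}) :
  (forall v, v \in X -> #|F v| <= a)%N -> (forall v, v \notin X -> #|F v| <= b)%N ->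
  (#|[set L : lists n m | [forall v, L v \in F v]]| <= a ^ #|X| * b ^ (n - #|X|))%N.
Proof.
move=> ha hb; rewrite card_lists (bigID (fun v => v \in X)) /= leq_mul //.
  by rewrite -prod_nat_const; apply: leq_prod.
have -> : (n - #|X|)%N = #|~: X| by rewrite [RHS]cardsCs setCK card_ord.
rewrite -prod_nat_const [leqRHS](eq_bigl (fun v => v \notin X)); last by move=> v; rewrite inE.
exact: leq_prod.
Qed.

Lemma card_draws_mem (m k : nat) (j : 'I_m) :
  (0 < k)%N -> (m * #|[set A : {set 'I_m} | (j \in A) && (#|A| == k)]| = k * 'C(m, k))%N.
Proof.
case: m j => [[]//|m] j; case: k => // k _; rewrite -mul_bin_diag /=; congr muln.
have := cardsID [set A : {set 'I_m.+1} | j \in A] [set A : {set 'I_m.+1} | #|A| == k.+1].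
rewrite card_draws card_ord binS.
have -> : [set A : {set 'I_m.+1} | #|A| == k.+1] :&: [set A : {set 'I_m.+1} | j \in A] =
    [set A : {set 'I_m.+1} | (j \in A) && (#|A| == k.+1)].
  by apply/setP => A; rewrite !inE andbC.
have -> : [set A : {set 'I_m.+1} | #|A| == k.+1] :\: [set A : {set 'I_m.+1} | j \in A] =
    [set A : {set 'I_m.+1} | (A \subset ~: [set j]) && (#|A| == k.+1)].
  by apply/setP => A; rewrite !inE subsetC sub1set inE.
by rewrite cards_draws cardsC1 card_ord /= addnC => /addnI.
Qed.

(** A union bound over the colours of [B]: two fixed vertices have intersecting lists with
    probability at most [k^2 / m]. *)
Lemma card_draws_meet (m k : nat) (B : {set 'I_m}) :
  (0 < k)%N -> #|B| = k ->
  (m * #|[set A : {set 'I_m} | (B :&: A != set0) && (#|A| == k)]| <= k * (k * 'C(m, k)))%N.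
Proof.
move=> k0 Bk.
apply: (@leq_trans (m * \sum_(j in B) #|[set A : {set 'I_m} | (j \in A) && (#|A| == k)]|)).
  rewrite leq_mul2l; apply/orP; right; apply: leq_trans (card_bigcup_le _ _).
  apply: subset_leq_card; apply/subsetP => A; rewrite inE => /andP[/set0Pn[j]].
  by rewrite inE => /andP[jB jA] Ak; apply/bigcupP; exists j; rewrite ?inE ?jA.
rewrite big_distrr /= (eq_bigr (fun=> k * 'C(m, k))%N) => [|j _]; last exact: card_draws_mem.
by rewrite sum_nat_const Bk.
Qed.

Definition agree (n m : nat) (X : {set 'I_n}) (L0 : 'I_n -> {set 'I_m}) (L : lists n m) : bool :=
  [forall v in X, L v == L0 v].

Lemma card_agree (n m k : nat) (X : {set 'I_n}) (L0 : 'I_n -> {set 'I_m}) :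
  (#|[set L : lists n m | is_list_assignment k L && agree X L0 L]| <= 'C(m, k) ^ (n - #|X|))%N.
Proof.
pose F v := if v \in X then [set L0 v] else [set A : {set 'I_m} | #|A| == k].
have := @card_lists_split n m 1 'C(m, k) X F.
rewrite exp1n mul1n => h; apply: leq_trans (h _ _).
- apply: subset_leq_card; apply/subsetP => L; rewrite !inE => /andP[/forallP h1 /forall_inP h2].
  by apply/forallP => v; rewrite /F; case: ifP => vX; rewrite inE ?h2.
- by move=> v; rewrite /F => ->; rewrite cards1.
- by move=> v /negbTE; rewrite /F => ->; rewrite card_draws card_ord.
Qed.

Lemma agree_reveal (n m k : nat) (X : {set 'I_n}) (L0 : 'I_n -> {set 'I_m}) (u : 'I_n)
    (K : {set {set 'I_m}}) (Q : pred (lists n m)) (b : nat) :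
  u \notin X -> (forall L, is_list_assignment k L -> agree X L0 L -> Q L -> L u \in K) ->
  (#|[set L : lists n m | [&& is_list_assignment k L, agree X L0 L & Q L]]| <=
   \sum_(A in K) #|[set L : lists n m | [&& is_list_assignment k L,
      agree (u |: X) (fun v => if v == u then A else L0 v) L & Q L]]|)%N.
Proof.
move=> uX hK; apply: leq_trans (card_bigcup_le _ _); apply: subset_leq_card.
apply/subsetP => L; rewrite inE => /and3P[vL aL qL]; apply/bigcupP.
exists (L u); first exact: hK.
rewrite inE vL qL andbT /=; apply/forall_inP => v; rewrite !inE.
by case: eqVneq => [->//|_] /= vX; have /forall_inP := aL; apply.
Qed.

Definition conflict (n m : nat) (L : 'I_n -> {set 'I_m}) (u v : 'I_n) : bool :=
  L u :&: L v != set0.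

(* Along edges with intersecting lists that are not in [Y], at least [s] vertices are reached from [X]
   (connectivity is expressed by cuts). *)
Definition reaches (n m : nat) (G : rel 'I_n) (s : nat) (X : {set 'I_n})
    (Y : {set 'I_n * 'I_n}) (L : lists n m) : bool :=
  [exists S : {set 'I_n}, [&& X \subset S, (s <= #|S|)%N & [forall A : {set 'I_n},
     (X \subset A) && (A \proper S) ==>
     [exists a in A, exists b in S :\: A, [&& G a b, conflict L a b & (a, b) \notin Y]]]]].

Lemma reachesP (n m : nat) (G : rel 'I_n) (s : nat) (X : {set 'I_n})
    (Y : {set 'I_n * 'I_n}) (L : lists n m) :
  reflect (exists S : {set 'I_n}, [/\ X \subset S, (s <= #|S|)%N &
     forall A : {set 'I_n}, X \subset A -> A \proper S ->
     exists a b, [/\ a \in A, b \in S :\: A, G a b, conflict L a b & (a, b) \notin Y]])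
    (reaches G s X Y L).
Proof.
apply: (iffP existsP) => [[S /and3P[h1 h2 /forallP h3]]|[S [h1 h2 h3]]]; exists S.
  split=> // A XA AS; have := h3 A; rewrite XA AS /= => /exists_inP[a aA /exists_inP[b bS]].
  by move=> /and3P[? ? ?]; exists a, b.
apply/and3P; split=> //; apply/forallP => A; apply/implyP => /andP[XA AS].
have [a [b [aA bS g c y]]] := h3 A XA AS.
by apply/exists_inP; exists a => //; apply/exists_inP; exists b => //; apply/and3P.
Qed.

(** Let [S] be a witness. If [u] lies in [S] and the lists of [x] and [u] meet, [u] may join [X];
    otherwise no cut of [S] relies on the pair, which may join [Y]. *)
Lemma reaches_step (n m : nat) (G : rel 'I_n) (s : nat) (X : {set 'I_n})
    (Y : {set 'I_n * 'I_n}) (L : lists n m) (x u : 'I_n) :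
  reaches G s X Y L ->
  (conflict L x u && reaches G s (u |: X) Y L) || reaches G s X ((x, u) |: Y) L.
Proof.
move=> /reachesP[S [XS sS h]]; have [/andP[c uS]|] := boolP (conflict L x u && (u \in S)).
  apply/orP; left; rewrite c /=; apply/reachesP; exists S; split=> //.
    by rewrite subUset sub1set uS.
  by move=> A; rewrite subUset => /andP[_ XA]; apply: h.
move=> ncu; apply/orP; right; apply/reachesP; exists S; split=> // A XA AS.
have [a [b [aA bS g cab yab]]] := h A XA AS; exists a, b; split=> //.
rewrite in_setU1 negb_or yab andbT; apply: contra ncu => /eqP[ax bu]; subst.
by rewrite cab; move: bS; rewrite inE => /andP[].
Qed.

Lemma reaches_stuck (n m : nat) (G : rel 'I_n) (s : nat) (X : {set 'I_n})
    (Y : {set 'I_n * 'I_n}) (L : lists n m) :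
  reaches G s X Y L -> (#|X| < s)%N ->
  exists x u, [/\ x \in X, u \notin X, G x u & (x, u) \notin Y].
Proof.
move=> /reachesP[S [XS sS h]] Xs.
have [||a [b [aX bS g _ y]]] := h X.
- exact: subxx.
- rewrite properEneq XS andbT; apply/eqP => e; rewrite -e in sS; lia.
by exists a, b; split=> //; move: bS; rewrite inE => /andP[].
Qed.

Definition explore_bound (R : realType) (B D : R) (d s x y : nat) : R :=
  B ^+ x / B ^+ s * (D ^+ (d * x) / D ^+ y).

(* Explore the component of [X] in the graph of edges with intersecting lists one directed edge at a
   time, revealing a list only when the tested edge is positive. [Y] is the set of edges tested
   negatively; no information on them is used, so the revealed lists stay independent. The potential
   [B ^ (x - s) * D ^ (d x - y)] is a supermartingale as [p B D^d + 1 / D <= 1] for [p = k^2 / m]. *)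
Lemma card_reaches (R : realType) (n m k d s : nat) (G : rel 'I_n) (B D : R) (M : nat)
    (X : {set 'I_n}) (Y : {set 'I_n * 'I_n}) (L0 : 'I_n -> {set 'I_m}) :
  (0 < k)%N -> (0 < m)%N -> 1 <= B -> 1 <= D ->
  (k ^ 2)%:R / m%:R * B * D ^+ d + D^-1 <= 1 ->
  (forall v, #|[set u | G v u]| <= d)%N ->
  (forall v, v \in X -> #|L0 v| = k) ->
  Y \subset [set e | (e.1 \in X) && G e.1 e.2] ->
  (n - #|X| + (n * n - #|Y|) < M)%N ->
  #|[set L : lists n m | [&& is_list_assignment k L, agree X L0 L & reaches G s X Y L]]|%:R <=
  explore_bound B D d s #|X| #|Y| * 'C(m, k)%:R ^+ (n - #|X|).
Proof.
move=> k0 m0 B1 D1 super degG; have B0 : 0 < B by lra.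
have D0 : 0 < D by lra.
have eb0 x y : 0 <= explore_bound B D d s x y.
  by rewrite /explore_bound !mulr_ge0 ?invr_ge0 ?exprn_ge0 // ltW.
elim: M X Y L0 => // M IH X Y L0 hL0 hY hM.
(* Once [s] vertices are reached the potential is at least 1, because the tested pairs start in [X]
   and hence [#|Y| <= d * #|X|]. *)
have [sX|Xs] := leqP s #|X|.
  apply: (@le_trans _ _ (1 * 'C(m, k)%:R ^+ (n - #|X|))).
    rewrite mul1r -natrX ler_nat; apply: leq_trans (card_agree k X L0).
    by apply: subset_leq_card; apply/subsetP => L; rewrite !inE => /and3P[-> ->].
  rewrite ler_wpM2r ?exprn_ge0 // /explore_bound.
  have cY : (#|Y| <= d * #|X|)%N.
    apply: leq_trans (subset_leq_card hY) _.
    rewrite -sum1dep_card -(pair_big_dep (fun x => x \in X) (fun x u => G x u) (fun _ _ => 1%N)) /=.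
    rewrite mulnC -sum_nat_const; apply: leq_sum => x _.
    by rewrite sum1dep_card.
  by rewrite mulr_ege1 // ler_pdivlMr ?exprn_gt0 // mul1r ler_weXn2l.
have [/existsP[x /existsP[u /and4P[xX uX gxu xuY]]]|none] := boolP [exists x, exists u,
    [&& x \in X, u \notin X, G x u & (x, u) \notin Y]]; last first.
  have -> : [set L : lists n m | [&& is_list_assignment k L, agree X L0 L & reaches G s X Y L]] = set0.
    apply/setP => L; rewrite inE in_set0; apply/negP => /and3P[_ _ /reaches_stuck/(_ Xs)].
    move=> [x [u [h1 h2 h3 h4]]]; case/negP: none; apply/existsP; exists x; apply/existsP; exists u.
    by rewrite h1 h2 h3.
  by rewrite cards0; apply: mulr_ge0 => //; apply: exprn_ge0.
have Xn : (#|X| < n)%N.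
  rewrite -[X in (_ < X)%N](card_ord n) -cardsT; apply: proper_card; apply/properP; split=> //.
  by exists u.
have YN : (#|Y| < n * n)%N.
  have -> : (n * n)%N = #|[set: 'I_n * 'I_n]| by rewrite cardsT card_prod card_ord.
  by apply: proper_card; apply/properP; split=> //; exists (x, u).
set c : R := 'C(m, k)%:R in IH *; have c0 : 0 <= c by rewrite /c.
set K := [set A : {set 'I_m} | (L0 x :&: A != set0) && (#|A| == k)].
have cK : #|K|%:R <= (k ^ 2)%:R / m%:R * c.
  rewrite mulrAC ler_pdivlMr ?ltr0n // /c -!natrM ler_nat mulnC.
  by have := card_draws_meet k0 (hL0 x xX); rewrite mulnA mulnn.
have cX1 : #|u |: X| = #|X|.+1 by rewrite cardsU1 uX.
have cY1 : #|(x, u) |: Y| = #|Y|.+1 by rewrite cardsU1 xuY.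
set T := [set L | _].
set T1 := [set L : lists n m | [&& is_list_assignment k L, agree X L0 L &
  conflict L x u && reaches G s (u |: X) Y L]].
set T2 := [set L : lists n m | [&& is_list_assignment k L, agree X L0 L &
  reaches G s X ((x, u) |: Y) L]].
have sub : T \subset T1 :|: T2.
  apply/subsetP => L; rewrite !inE => /and3P[-> -> /(reaches_step x u)] /=.
  by rewrite ?andTb.
have h2 : #|T2|%:R <= explore_bound B D d s #|X| #|Y|.+1 * c ^+ (n - #|X|).
  rewrite -cY1; apply: IH => //; last by rewrite cY1; clear -hM YN; lia.
  by rewrite subUset sub1set hY inE xX gxu.
have h1 : #|T1|%:R <= #|K|%:R * (explore_bound B D d s #|X|.+1 #|Y| * c ^+ (n - #|X|.+1)).
  apply: (@le_trans _ _ (\sum_(A in K) #|[set L : lists n m | [&& is_list_assignment k L,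
      agree (u |: X) (fun v => if v == u then A else L0 v) L & reaches G s (u |: X) Y L]]|)%:R).
    rewrite ler_nat; apply: leq_trans (@agree_reveal n m k X L0 u K _ 0 uX _) _.
      move=> L /forallP/(_ u) Lu /forall_inP/(_ x xX)/eqP Lx /andP[cxu _].
      by rewrite inE Lu -Lx andbT.
    apply: leq_sum => A _; apply: subset_leq_card; apply/subsetP => L.
    by rewrite !inE => /and3P[-> -> /andP[_ ->]].
  rewrite mulr_natl -sumr_const natr_sum; apply: ler_sum => A; rewrite inE => /andP[_ /eqP Ak].
  rewrite -cX1; apply: IH.
  - by move=> v; rewrite !inE; case: eqVneq => //= _; apply: hL0.
  - apply: subset_trans hY _; apply/subsetP => e; rewrite !inE => /andP[-> ->].
    by rewrite orbT.
  - by rewrite cX1; clear -hM Xn; lia.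
apply: (@le_trans _ _ (#|T1| + #|T2|)%:R).
  by rewrite ler_nat; apply: leq_trans (subset_leq_card sub) (leq_card_setU _ _).
rewrite natrD; apply: le_trans (lerD h1 h2) _.
have e1 : explore_bound B D d s #|X|.+1 #|Y| = B * D ^+ d * explore_bound B D d s #|X| #|Y|.
  by rewrite /explore_bound exprS mulnS exprD; ring.
have e2 : explore_bound B D d s #|X| #|Y|.+1 = D^-1 * explore_bound B D d s #|X| #|Y|.
  by rewrite /explore_bound exprS invfM; ring.
rewrite e1 e2; set b := explore_bound _ _ _ _ _ _.
have -> : (n - #|X| = (n - #|X|.+1).+1)%N by clear -Xn; lia.
rewrite exprS; set z := c ^+ (n - _); have z0 : 0 <= z by apply: exprn_ge0.
have b0 : 0 <= b by apply: eb0.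
apply: (@le_trans _ _ ((k ^ 2)%:R / m%:R * c * (B * D ^+ d * b * z) + D^-1 * b * (c * z))).
  rewrite lerD2r; apply: ler_wpM2r; last exact: cK.
  apply: mulr_ge0 z0; apply: mulr_ge0 b0; apply: mulr_ge0 (ltW B0) _.
  exact: exprn_ge0 (ltW D0).
have -> : (k ^ 2)%:R / m%:R * c * (B * D ^+ d * b * z) + D^-1 * b * (c * z) =
  ((k ^ 2)%:R / m%:R * B * D ^+ d + D^-1) * (b * (c * z)) by ring.
by apply: ler_piMl super; apply: mulr_ge0 b0 _; apply: mulr_ge0 c0 z0.
Qed.

Lemma card_reaches_root (R : realType) (n m k d s : nat) (G : rel 'I_n) (B D : R) :
  (0 < k)%N -> (0 < m)%N -> 1 <= B -> 1 <= D ->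
  (k ^ 2)%:R / m%:R * B * D ^+ d + D^-1 <= 1 ->
  (forall v, #|[set u | G v u]| <= d)%N ->
  #|[set L : lists n m | is_list_assignment k L && [exists v, reaches G s [set v] set0 L]]|%:R <=
  n%:R * explore_bound B D d s 1 0 * 'C(m, k)%:R ^+ n.
Proof.
move=> k0 m0 B1 D1 super degG.
set e := explore_bound _ _ _ _ _ _; set c : R := 'C(m, k)%:R.
have root v : #|[set L : lists n m | is_list_assignment k L && reaches G s [set v] set0 L]|%:R <=
    e * c ^+ n.
  have n0 : (0 < n)%N by case: n v {G degG} => [[]|].
  pose K := [set A : {set 'I_m} | #|A| == k].
  have cK : #|K| = 'C(m, k) by rewrite card_draws card_ord.
  apply: (@le_trans _ _ (\sum_(A in K) #|[set L : lists n m | [&& is_list_assignment k L,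
      agree (v |: set0) (fun u => if u == v then A else set0) L & reaches G s [set v] set0 L]]|)%:R).
    rewrite ler_nat; apply: leq_trans (@agree_reveal n m k set0 (fun=> set0) v K _ 0 _ _).
    - apply: subset_leq_card; apply/subsetP => L; rewrite !inE => /andP[-> ->].
      by rewrite andbT /=; apply/forall_inP => u; rewrite in_set0.
    - by rewrite in_set0.
    - by move=> L /forallP/(_ v) Lv _ _; rewrite inE.
  have -> : e * c ^+ n = #|K|%:R * (e * c ^+ n.-1).
    by rewrite cK -/c mulrCA -exprS prednK.
  rewrite mulr_natl -sumr_const natr_sum; apply: ler_sum => A; rewrite inE => /eqP Ak.
  rewrite setU0; have := @card_reaches R n m k d s G B D
    (n - #|[set v]| + (n * n - #|set0 : {set 'I_n * 'I_n}|)).+1 [set v] set0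
    (fun u => if u == v then A else set0) k0 m0 B1 D1 super degG.
  rewrite cards1 cards0 subn1; apply=> //; last exact: sub0set.
  by move=> u; rewrite inE => ->.
apply: (@le_trans _ _ (\sum_(v : 'I_n) #|[set L : lists n m | is_list_assignment k L &&
    reaches G s [set v] set0 L]|)%:R).
  rewrite ler_nat; apply: leq_trans (card_bigcup_le _ _); apply: subset_leq_card.
  apply/subsetP => L; rewrite inE => /andP[vL /existsP[v hv]]; apply/bigcupP.
  by exists v; rewrite // inE vL.
rewrite natr_sum; apply: (@le_trans _ _ (\sum_(v : 'I_n) e * c ^+ n)); first exact: ler_sum.
by rewrite sumr_const card_ord -mulrA mulr_natl.
Qed.

(** * Minimal uncolourable sets *)

Definition doubled (n m : nat) (S : {set 'I_n}) (L : 'I_n -> {set 'I_m}) : bool :=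
  [forall v in S, forall c in L v, exists u in S, (u != v) && (c \in L u)].

Lemma doubled_colours (n m k : nat) (S : {set 'I_n}) (L : 'I_n -> {set 'I_m}) :
  (forall v, v \in S -> #|L v| = k) -> doubled S L ->
  (#|\bigcup_(v in S) L v| <= (k * #|S|)./2)%N.
Proof.
move=> Lk /forall_inP dbl; set W := \bigcup_(v in S) L v.
rewrite geq_half_double -muln2 -sum_nat_const.
have -> : (k * #|S| = \sum_(v in S) \sum_(c in L v) 1)%N.
  rewrite mulnC -sum_nat_const; apply: eq_bigr => v vS.
  by rewrite sum1_card Lk.
rewrite (exchange_big_dep (fun c => c \in W)) /=; last first.
  by move=> v c vS cL; apply/bigcupP; exists v.
apply: leq_sum => c /bigcupP[v vS cL].
have /forall_inP/(_ c cL)/exists_inP[u uS /andP[uv cu]] := dbl v vS.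
rewrite (bigD1 v) ?vS //= (bigD1 u) //=; last by rewrite uS cu uv.
Qed.

Lemma bin_leq_exp (n k : nat) : ('C(n, k) <= n ^ k)%N.
Proof.
apply: (@leq_trans ('C(n, k) * k`!)); first by rewrite leq_pmulr ?fact_gt0.
rewrite bin_ffact; elim: k => // k IH; rewrite ffactnSr expnSr leq_mul //.
exact: leq_subr.
Qed.

(** Enumerate the colours on [S] by a map [g] from ['I_d], padded with [ord0]: there are [m ^ d]
    maps. Once [g] is fixed, each list on [S] is a [k]-subset of its image, and the other lists are
    free. *)
Lemma card_doubled (n m k : nat) (S : {set 'I_n}) :
  (0 < k)%N -> (0 < m)%N ->
  (#|[set L : lists n m | is_list_assignment k L && doubled S L]| <=
   m ^ (k * #|S|)./2 * (((k * #|S|) ^ k) ^ #|S| * 'C(m, k) ^ (n - #|S|)))%N.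
Proof.
case: m => // m k0 _; set d := (k * #|S|)./2.
pose img (g : {ffun 'I_d -> 'I_m.+1}) := [set g i | i in 'I_d].
pose F g v := if v \in S then [set A : {set 'I_m.+1} | (A \subset img g) && (#|A| == k)]
              else [set A : {set 'I_m.+1} | #|A| == k].
apply: (@leq_trans #|\bigcup_(g : {ffun 'I_d -> 'I_m.+1}) [set L : lists n m.+1 | [forall v, L v \in F g v]]|).
  apply: subset_leq_card; apply/subsetP => L; rewrite inE => /andP[/forallP vL dbl].
  have cW := doubled_colours (fun v _ => eqP (vL v)) dbl.
  set W := \bigcup_(v in S) L v in cW.
  apply/bigcupP; exists [ffun i : 'I_d => nth ord0 (enum W) i] => //.
  rewrite inE; apply/forallP => v; rewrite /F; case: ifP => vS; rewrite inE vL // andbT.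
  apply/subsetP => c cL; have cW' : c \in enum W by rewrite mem_enum; apply/bigcupP; exists v.
  have id : (index c (enum W) < d)%N.
    by apply: leq_trans cW; rewrite cardE index_mem.
  by apply/imsetP; exists (Ordinal id) => //; rewrite ffunE /= nth_index.
apply: leq_trans (card_bigcup_le _ _) _.
have -> : (m.+1 ^ d = #|{ffun 'I_d -> 'I_m.+1}|)%N by rewrite card_ffun !card_ord.
rewrite -sum_nat_const; apply: leq_sum => g _.
apply: card_lists_split => v; rewrite /F; last by move=> /negbTE ->; rewrite card_draws card_ord.
move=> ->; rewrite cards_draws; apply: leq_trans (bin_leq_exp _ _) _; rewrite leq_exp2r //.
apply: leq_trans (leq_imset_card _ _) _; rewrite card_ord /d -divn2.
exact: leq_div.
Qed.

Definition connected_set (n : nat) (G : rel 'I_n) (S : {set 'I_n}) : bool :=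
  [forall A : {set 'I_n}, (A != set0) && (A \proper S) ==>
     [exists a in A, exists b in S :\: A, G a b]].

Definition nbhd (n : nat) (G : rel 'I_n) (A : {set 'I_n}) : {set 'I_n} :=
  [set u | [exists a in A, G a u]].

Fixpoint grown_sets (n : nat) (G : rel 'I_n) (j : nat) : {set {set 'I_n}} :=
  if j is j'.+1 then \bigcup_(A in grown_sets G j') [set u |: A | u in nbhd G A]
  else [set [set v] | v : 'I_n].

(** Build the set vertex by vertex: a new vertex is adjacent to one of at most [s.+1] present ones,
    so it has at most [s.+1 * d] choices. What this loses against a bound of type [(e d)^s] is a
    factor [s] per vertex, which is logarithmic in [n] for the sizes in question. *)
Lemma card_connected (n d s : nat) (G : rel 'I_n) :
  (forall v, #|[set u | G v u]| <= d)%N ->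
  (#|[set S | connected_set G S && (#|S| == s.+1)]| <= n * (s.+1 * d) ^ s)%N.
Proof.
move=> degG.
have cA j A : A \in grown_sets G j -> (#|A| <= j.+1)%N.
  elim: j A => [|j IH] A; first by move=> /imsetP[v _ ->]; rewrite cards1.
  move=> /bigcupP[A' /IH hA' /imsetP[u _ ->]]; rewrite cardsU1.
  by case: (u \notin A'); rewrite /= ?add1n ?add0n // ltnW.
have cN A : (#|nbhd G A| <= #|A| * d)%N.
  apply: (@leq_trans #|\bigcup_(a in A) [set u | G a u]|).
    apply: subset_leq_card; apply/subsetP => u; rewrite inE => /exists_inP[a aA gau].
    by apply/bigcupP; exists a; rewrite ?inE.
  apply: leq_trans (card_bigcup_le _ _) _; rewrite -sum_nat_const.
  by apply: leq_sum => a _.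
have cF j : (j <= s)%N -> (#|grown_sets G j| <= n * (s.+1 * d) ^ j)%N.
  elim: j => [|j IH] js.
    by rewrite muln1; apply: leq_trans (leq_imset_card _ _) _; rewrite card_ord.
  apply: leq_trans (card_bigcup_le _ _) _.
  apply: (@leq_trans (\sum_(A in grown_sets G j) (s.+1 * d))).
    apply: leq_sum => A hA; apply: leq_trans (leq_imset_card _ _) _.
    apply: leq_trans (cN A) _; rewrite leq_mul2r (leq_trans (cA j A hA)) ?orbT //.
    exact: leq_trans js (leqnSn s).
  by rewrite sum_nat_const expnSr [leqRHS]mulnA leq_mul2r IH ?orbT // ltnW.
apply: leq_trans (cF s (leqnn s)); apply: subset_leq_card; apply/subsetP => S.
rewrite inE => /andP[/forallP conn /eqP Ss].
have [v vS] : exists v, v \in S by apply/set0Pn; rewrite -cards_eq0 Ss.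
have grow j : (j <= s)%N -> exists A, [/\ A \in grown_sets G j, A \subset S & #|A| = j.+1].
  elim: j => [|j IH] js.
    by exists [set v]; rewrite sub1set cards1; split=> //; apply/imsetP; exists v.
  have [A [hA AS Aj]] := IH (ltnW js).
  have := conn A; rewrite -cards_eq0 Aj /= properEcard AS Aj Ss ltnS js /=.
  move=> /exists_inP[a aA /exists_inP[b]]; rewrite inE => /andP[bA bS] gab.
  exists (b |: A); split; last by rewrite cardsU1 bA Aj.
    apply/bigcupP; exists A => //; apply/imsetP; exists b => //.
    by rewrite inE; apply/exists_inP; exists a.
  by rewrite subUset sub1set bS.
have [A [hA AS As]] := grow s (leqnn s).
suff -> : S = A by [].
by apply/eqP; rewrite eq_sym eqEcard AS As Ss leqnn.
Qed.

(** Remove [v] and colour the rest: a colour of [L v] on no other list of [S] would finish the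
    colouring. Likewise, colourings of [A] and of its complement in [S] can be merged unless an edge
    with intersecting lists joins them. *)
Lemma minimal_uncolourable (n m : nat) (G : rel 'I_n) (L : 'I_n -> {set 'I_m}) :
  symmetric G -> irreflexive G -> (0 < m)%N -> ~~ colourable_on G L [set: 'I_n] ->
  exists S : {set 'I_n}, [/\ S != set0, ~~ colourable_on G L S, doubled S L &
    forall A : {set 'I_n}, A != set0 -> A \proper S ->
      exists a b, [/\ a \in A, b \in S :\: A, G a b & conflict L a b]].
Proof.
case: m L => // m L Gs Gi _ /(minset_exists (P := fun S => ~~ colourable_on G L S)).
move=> [S /minsetP[nS Smin] _].
have Sn0 : S != set0 by apply: contra nS => /eqP ->; apply: colourable_on0 ord0 _ _.
have sub (A : {set 'I_n}) : A \proper S -> colourable_on G L A.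
  move=> AS; apply: contraT => nA; have e := Smin A nA (proper_sub AS).
  by move: AS; rewrite e properxx.
exists S; split=> //.
  apply/forall_inP => v vS; apply/forall_inP => c cL; apply: contraR nS => none.
  have /sub/colourable_onP[f [f1 f2]] := properD1 vS.
  have fne u : u \in S -> u != v -> f u != c.
    move=> uS uv; apply: contra none => /eqP fu; apply/exists_inP; exists u => //.
    by rewrite uv -fu f1 // !inE uv.
  apply/colourable_onP; exists (fun u => if u == v then c else f u); split=> [u uS|u w uS wS guw].
    by case: eqVneq => [->//|uv]; apply: f1; rewrite !inE uv.
  case: (eqVneq u v) => [uv|uv]; case: (eqVneq w v) => [wv|wv].
  - by move: guw; rewrite uv wv Gi.
  - by rewrite eq_sym; apply: fne.
  - exact: fne.
  - by apply: f2; rewrite ?inE ?uv ?wv.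
move=> A A0 AS; apply: contrapT => none; case/negP: nS.
have /colourable_onP[f [f1 f2]] := sub A AS.
have /sub : S :\: A \proper S.
  rewrite properEneq subsetDl andbT; apply: contra A0 => /eqP e; rewrite -subset0.
  apply/subsetP => a aA; have := subsetP (proper_sub AS) a aA.
  by rewrite -e inE aA.
move=> /colourable_onP[g [g1 g2]].
have cross a b : a \in A -> b \in S :\: A -> G a b -> f a != g b.
  move=> aA bS gab; apply/eqP => fg; apply: none; exists a, b; split=> //.
  by apply/set0Pn; exists (f a); rewrite inE f1 // fg g1.
apply/colourable_onP; exists (fun u => if u \in A then f u else g u); split=> [u uS|u w uS wS guw].
  by case: ifP => uA; [apply: f1|apply: g1; rewrite inE uA].
case: ifP => uA; case: ifP => wA.
- exact: f2.
- by apply: cross; rewrite // inE wA.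
- by rewrite eq_sym; apply: cross; rewrite ?inE ?uA // Gs.
- by apply: g2; rewrite // inE ?uA ?wA.
Qed.

(** A minimal uncolourable set has at least [N0] vertices. From size [T] on the exploration bound
    applies; below [T], a union bound over connected sets whose colours are doubled. *)
Lemma card_uncolourable (R : realType) (n m k d N0 T : nat) (G : rel 'I_n) (B D : R) :
  symmetric G -> irreflexive G -> (0 < k)%N -> (k <= m)%N -> (0 < d)%N -> (0 < N0)%N -> 1 <= B -> 1 <= D ->
  (k ^ 2)%:R / m%:R * B * D ^+ d + D^-1 <= 1 ->
  (forall v, #|[set u | G v u]| <= d)%N ->
  (forall (L : 'I_n -> {set 'I_m}) (S : {set 'I_n}), (forall v, v \in S -> #|L v| = k) ->
     (#|S| < N0)%N -> colourable_on G L S) ->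
  #|[set L : lists n m | is_list_assignment k L && ~~ list_colourable G L]|%:R <=
  (n%:R * explore_bound B D d T 1 0 +
   \sum_(s < n.+1 | (N0 <= s < T)%N) n%:R * (s * d)%:R ^+ s * m%:R ^+ (k * s)./2 *
     (k * s)%:R ^+ (k * s) / 'C(m, k)%:R ^+ s) * 'C(m, k)%:R ^+ n.
Proof.
move=> Gs Gi k0 km d0 N00 B1 D1 super degG choos; have m0 : (0 < m)%N by apply: leq_trans km.
set c : R := 'C(m, k)%:R; have c0 : 0 < c by rewrite ltr0n bin_gt0.
set bad := [set L | _].
pose big := [set L : lists n m | is_list_assignment k L && [exists v, reaches G T [set v] set0 L]].
pose dbl (S : {set 'I_n}) := [set L : lists n m | is_list_assignment k L && doubled S L].
pose conn s := [set S | connected_set G S && (#|S| == s)].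
have sub : bad \subset big :|: \bigcup_(s < n.+1 | (N0 <= s < T)%N) \bigcup_(S in conn s) dbl S.
  apply/subsetP => L; rewrite [L \in bad]inE => /andP[vL ncol].
  have Lk v : #|L v| = k by move/forallP: vL => /(_ v)/eqP.
  have nc : ~~ colourable_on G L [set: 'I_n].
    apply: contra ncol => /colourable_onP[f [f1 f2]]; apply/existsP; exists (finfun f).
    apply/andP; split; first by apply/forallP => v; rewrite ffunE f1 ?inE.
    by apply/forallP => u; apply/forallP => v; apply/implyP => guv; rewrite !ffunE f2 ?inE.
  have [S [S0 nS dS cS]] := minimal_uncolourable Gs Gi m0 nc.
  have SN : (N0 <= #|S|)%N by rewrite leqNgt; apply: contra nS; apply: choos.
  rewrite in_setU; have [TS|ST] := leqP T #|S|.
    apply/orP; left; rewrite inE vL /=; have /set0Pn[v vS] := S0.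
    apply/existsP; exists v; apply/reachesP; exists S; split=> //; first by rewrite sub1set.
    move=> A; rewrite sub1set => vA AS; have [|a [b [? ? ? ?]]] := cS A _ AS.
      by apply/set0Pn; exists v.
    by exists a, b; split=> //; rewrite in_set0.
  apply/orP; right.
  have Sn : (#|S| < n.+1)%N by rewrite ltnS -[leqRHS](card_ord n) max_card.
  apply/bigcupP; exists (Ordinal Sn) => /=; first by rewrite SN ST.
  apply/bigcupP; exists S; last by rewrite inE vL.
  rewrite inE eqxx andbT; apply/forallP => A; apply/implyP => /andP[A0 AS].
  have [a [b [aA bS gab _]]] := cS A A0 AS.
  by apply/exists_inP; exists a => //; apply/exists_inP; exists b.
have cdbl S : #|dbl S|%:R <= m%:R ^+ (k * #|S|)./2 * (k * #|S|)%:R ^+ (k * #|S|) / c ^+ #|S| * c ^+ n.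
  have := card_doubled S k0 m0; rewrite -(ler_nat R) => /le_trans; apply.
  have Sn : (#|S| <= n)%N by rewrite -[leqRHS](card_ord n) max_card.
  rewrite 2!natrM !natrX -/c -exprM -!mulrA; do 2 rewrite ler_wpM2l ?exprn_ge0 //.
  by rewrite mulrC -exprB ?unitfE ?gt_eqF // lexx.
apply: (@le_trans _ _ (#|big| + \sum_(s < n.+1 | (N0 <= s < T)%N) \sum_(S in conn s) #|dbl S|)%:R).
  rewrite ler_nat; apply: leq_trans (subset_leq_card sub) _.
  apply: leq_trans (leq_card_setU _ _) _; rewrite leq_add2l.
  apply: leq_trans (card_bigcup_le _ _) _; apply: leq_sum => s _.
  exact: card_bigcup_le.
rewrite natrD mulrDl lerD //; first exact: card_reaches_root.
rewrite natr_sum mulr_suml; apply: ler_sum => s /andP[Ns sT].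
rewrite natr_sum; set t := m%:R ^+ (k * s)./2 * (k * s)%:R ^+ (k * s) / c ^+ s * c ^+ n.
have t0 : 0 <= t by rewrite /t !mulr_ge0 ?invr_ge0 ?exprn_ge0 // ltW.
apply: (@le_trans _ _ (\sum_(S in conn s) t)).
  by apply: ler_sum => S; rewrite inE => /andP[_ /eqP Ss]; have := cdbl S; rewrite Ss.
rewrite sumr_const -(mulr_natl t).
have -> : n%:R * (s * d)%:R ^+ s * m%:R ^+ (k * s)./2 * (k * s)%:R ^+ (k * s) / c ^+ s * c ^+ n =
  n%:R * (s * d)%:R ^+ s * t by rewrite /t; ring.
rewrite ler_wpM2r // -natrX -natrM ler_nat.
move: Ns N00; case: (nat_of_ord s) => [|s'] Ns N00; first by rewrite leqNgt N00 in Ns.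
apply: leq_trans (@card_connected n d s' G degG) _.
by rewrite leq_mul2l leq_pexp2l ?orbT // muln_gt0.
Qed.

(** * Asymptotics *)

Lemma half_le_ln2 (R : realType) : 2^-1 <= ln (2 : R).
Proof.
have -> : (2 : R) = (1 - 2^-1)^-1 by field.
rewrite lnV ?posrE; last by lra.
by rewrite lerNr; apply: le_trans (le_ln1Dx _) _; lra.
Qed.

Lemma expR1_bound (R : realType) : expR 1 <= (281 / 100 : R).
Proof.
have h : (15 / 16 : R) <= expR (- (16^-1)).
  by apply: le_trans (expR_ge1Dx _); lra.
have e : expR 1 * expR (- (16^-1)) ^+ 16 = 1 :> R.
  have z : 1 + 16%:R * - (16^-1) = 0 :> R by field.
  by rewrite -expRM_natl -expRD z expR0.
have p : (15 / 16 : R) ^+ 16 <= expR (- (16^-1)) ^+ 16.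
  by rewrite lerXn2r ?nnegrE ?expR_ge0 //; lra.
have q : (100 / 281 : R) <= (15 / 16) ^+ 16 by lra.
have e0 := expR_gt0 (1 : R); nra.
Qed.

(** For large [n], [ln n] is at least a quarter of [(trunc_log 2 n).+1]. The exponential exceeds its
    Taylor term of degree [j.+1], whose extra factor absorbs [K]. *)
Lemma polylog_le_powR (R : realType) (a K : R) (j : nat) :
  0 < a -> exists n0, forall n, (n0 <= n)%N ->
  K * (trunc_log 2 n).+1%:R ^+ j <= n%:R `^ a.
Proof.
move=> a0; pose b := (a / 4) ^+ j.+1 / (j.+1)`!%:R.
have b0 : 0 < b by rewrite divr_gt0 ?exprn_gt0 ?ltr0n ?fact_gt0 // divr_gt0.
pose N := (Num.bound `|K / b|).+1; exists (2 ^ N)%N => n hn.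
have n0 : (0 < n)%N by apply: leq_trans hn; rewrite expn_gt0.
set t := trunc_log 2 n.
have Nt : (N <= t)%N by rewrite -ltnS -(ltn_exp2l _ _ (isT : 1 < 2)%N); apply: leq_ltn_trans hn (trunc_log_ltn _ _).
have tn : (2 ^ t <= n)%N by apply: trunc_logP.
have lt : t.+1%:R / 4 <= ln (n%:R : R).
  apply: (@le_trans _ _ (t%:R * ln 2)).
    have t1 : 1 <= t%:R :> R by rewrite ler1n; apply: leq_trans Nt.
    have := @half_le_ln2 R; have : t.+1%:R = t%:R + 1 :> R by rewrite -natr1.
    by move=> ->; nra.
  rewrite mulr_natl -lnXn // -natrX ler_ln ?posrE ?ltr0n ?expn_gt0 // ler_nat //.
have bK : K <= b * t.+1%:R.
  rewrite mulrC -ler_pdivrMr //; apply: le_trans (ler_norm _) _.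
  apply: le_trans (ltW (archi_boundP (normr_ge0 _))) _; rewrite ler_nat.
  by apply: leq_trans (leqnSn _) _; apply: leq_trans Nt _.
rewrite /powR gt_eqF ?ltr0n //.
apply: le_trans (_ : (a / 4 * t.+1%:R) ^+ j.+1 / (j.+1)`!%:R <= _).
  rewrite exprMn mulrAC -/b exprS mulrA ler_wpM2r ?exprn_ge0 //.
apply: (@le_trans _ _ (expR (a / 4 * t.+1%:R))).
  have x0 : 0 <= a / 4 * t.+1%:R by rewrite mulr_ge0 // divr_ge0 // ltW.
  by apply: le_trans _ (expR_ge1Dxn j x0); rewrite lerDr.
by rewrite ler_expR -mulrA ler_wpM2l ?(ltW a0) // mulrC.
Qed.

Lemma ffact_leq_exp (n k : nat) : (n ^_ k <= n ^ k)%N.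
Proof.
elim: k => // k IH; rewrite ffactnSr expnSr leq_mul //; exact: leq_subr.
Qed.

Lemma leq_exp_bin (m k : nat) : (2 * k <= m)%N -> (m ^ k <= (2 * k) ^ k * 'C(m, k))%N.
Proof.
move=> km.
have h j : (j <= k)%N -> ((m - k) ^ j <= m ^_ j)%N.
  elim: j => // j IH jk; rewrite expnSr ffactnSr leq_mul ?IH ?(ltnW jk) //.
  by rewrite leq_sub2l // ltnW.
apply: (@leq_trans ((2 * (m - k)) ^ k)).
  by case: k km {h} => // k km; rewrite leq_exp2r //; lia.
rewrite !expnMn -mulnA leq_mul2l; apply/orP; right.
apply: leq_trans (h k (leqnn k)) _; rewrite -bin_ffact mulnC leq_mul2r.
by rewrite -[k`!]ffactnn ffact_leq_exp orbT.
Qed.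

(** With [mu = m^(k/2)], the choice of colours costs at most [mu^s], while ['C(m, k)^s] is at least
    [mu^(2s)] up to powers of [2k]; the net gain is [mu] per vertex. *)
Lemma doubled_term_bound (R : realType) (n m k d s : nat) :
  (0 < k)%N -> (2 * k <= m)%N ->
  n%:R * (s * d)%:R ^+ s * m%:R ^+ (k * s)./2 * (k * s)%:R ^+ (k * s) / 'C(m, k)%:R ^+ s <=
  n%:R * ((s * d)%:R * (k * s)%:R ^+ k * (2 * k)%:R ^+ k / m%:R `^ (k%:R / 2)) ^+ s :> R.
Proof.
move=> k0 km; set mu := m%:R `^ _.
have m0 : (0 < m)%N by lia.
have m1 : 1 <= m%:R :> R by rewrite ler1n.
have mu0 : 0 < mu by apply: powR_gt0; rewrite ltr0n.
have muE : m%:R ^+ k = mu ^+ 2.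
  by rewrite -(powR_mulrn _ (ltW mu0)) -powR_mulrn // /mu -powRrM divfK.
have c0 : 0 < 'C(m, k)%:R :> R by rewrite ltr0n bin_gt0; lia.
have cb : mu ^+ 2 <= (2 * k)%:R ^+ k * 'C(m, k)%:R.
  by rewrite -muE -!natrX -natrM ler_nat leq_exp_bin.
have half : m%:R ^+ (k * s)./2 <= mu ^+ s.
  rewrite -(powR_mulrn _ (ltW mu0)) -powR_mulrn // /mu -powRrM; apply: ler_powR => //.
  rewrite mulrAC -natrM ler_pdivlMr // -natrM ler_nat; lia.
have ci : ('C(m, k)%:R ^+ s)^-1 <= ((2 * k)%:R ^+ k / mu ^+ 2) ^+ s.
  rewrite -exprVn lerXn2r ?nnegrE ?invr_ge0 ?(ltW c0) //.
    by rewrite divr_ge0 ?exprn_ge0 // ltW.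
  by rewrite ler_pdivlMr ?exprn_gt0 // mulrC ler_pdivrMr.
have -> : n%:R * ((s * d)%:R * (k * s)%:R ^+ k * (2 * k)%:R ^+ k / mu) ^+ s =
  n%:R * (s * d)%:R ^+ s * mu ^+ s * (k * s)%:R ^+ (k * s) * ((2 * k)%:R ^+ k / mu ^+ 2) ^+ s :> R.
  have e : (s * d)%:R * (k * s)%:R ^+ k * (2 * k)%:R ^+ k / mu =
      (s * d)%:R * mu * (k * s)%:R ^+ k * ((2 * k)%:R ^+ k / mu ^+ 2).
    by field; rewrite gt_eqF.
  by rewrite e !exprMn -exprM; ring.
apply: ler_pM => //.
rewrite ler_wpM2r ?exprn_ge0 // ler_wpM2l // mulr_ge0 ?exprn_ge0 //.
Qed.

(** With [D = 1 + 1/d] one has [D^d <= 2.81] and [1 - 1/D = 1/(d + 1)], so the condition becomes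
    [1.05 * 2.81 * (d + 1) / (3 d) <= 1], true for [d >= 100]. The base [B = 21/20] above 1 makes
    large components improbable. *)
Lemma explore_super (R : realType) (k m d : nat) :
  (100 <= d)%N -> (0 < m)%N -> (3 * k ^ 2 * d <= m)%N ->
  (1 + d%:R^-1) ^+ d <= (281 / 100 : R) /\
  (k ^ 2)%:R / m%:R * (21 / 20) * (1 + d%:R^-1) ^+ d + (1 + d%:R^-1)^-1 <= 1 :> R.
Proof.
move=> d100 m0 hm.
have dR : 100 <= d%:R :> R by rewrite (ler_nat R 100).
have d0 : 0 < d%:R :> R by lra.
have Dd : (1 + d%:R^-1) ^+ d <= (281 / 100 : R).
  apply: le_trans (expR1_bound R).
  have -> : expR 1 = expR (d%:R^-1) ^+ d :> R.
    by rewrite -expRM_natl divff // gt_eqF.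
  by rewrite lerXn2r ?nnegrE ?expR_ge0 ?expR_ge1Dx // addr_ge0 // invr_ge0 ltW.
split=> //.
have p : (k ^ 2)%:R / m%:R <= (3 * d%:R)^-1 :> R.
  rewrite ler_pdivrMr ?ltr0n // mulrC ler_pdivlMr; last by lra.
  by rewrite -!natrM ler_nat; apply: leq_trans hm; rewrite mulnA [(k ^ 2 * 3)%N]mulnC.
have p0 : 0 <= (k ^ 2)%:R / m%:R :> R by rewrite divr_ge0.
have e : (1 + d%:R^-1)^-1 = 1 - (d%:R + 1)^-1 :> R by field; rewrite !gt_eqF //; lra.
rewrite e -lerBrDr subKr.
apply: (@le_trans _ _ ((3 * d%:R)^-1 * (21 / 20) * (281 / 100))).
  apply: ler_pM Dd; first by rewrite mulr_ge0 //; lra.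
    by rewrite exprn_ge0 // addr_ge0 // invr_ge0 ltW.
  by rewrite ler_wpM2r //; lra.
rewrite -[leRHS]mul1r ler_pdivlMr; last by lra.
have -> : (3 * d%:R)^-1 * (21 / 20) * (281 / 100) * (d%:R + 1) =
   (21 / 20 * (281 / 100) / 3) * ((d%:R + 1) / d%:R) :> R by field; rewrite gt_eqF.
have h : (d%:R + 1) / d%:R <= 101 / 100 :> R by rewrite ler_pdivrMr //; lra.
lra.
Qed.

(** [maxdeg] and [prob_colourable] count classical sets, the proof counts [{set _}]. *)
Lemma card_mkset (T : finType) (p : pred T) :
  #|[set x | p x]%classic| = #|[set x | p x]|.
Proof. by apply: eq_card => x; rewrite [RHS]inE; apply/asboolP/idP. Qed.

Lemma card_list_assignments (n m k : nat) :
  #|[set L : lists n m | is_list_assignment k L]| = ('C(m, k) ^ n)%N.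
Proof.
rewrite -[n in RHS](card_ord n) -prod_nat_const.
have -> : (\prod_(v in 'I_n) 'C(m, k) = \prod_(v : 'I_n) #|[set A : {set 'I_m} | #|A| == k]|)%N.
  by apply: eq_bigr => v _; rewrite card_draws card_ord.
rewrite -card_lists; apply: eq_card => L; rewrite !inE.
by apply: eq_forallb => v; rewrite inE.
Qed.

Lemma prob_uncolourable (R : realType) (n m k : nat) (G : rel 'I_n) (r : R) :
  (k <= m)%N ->
  #|[set L : lists n m | is_list_assignment k L && ~~ list_colourable G L]|%:R <=
    r * 'C(m, k)%:R ^+ n ->
  `|1 - prob_colourable R k m G| <= r.
Proof.
move=> km h; rewrite /prob_colourable !card_mkset card_list_assignments natrX.
have c0 : 0 < 'C(m, k)%:R ^+ n :> R by rewrite exprn_gt0 // ltr0n bin_gt0.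
have e : #|[set L : lists n m | is_list_assignment k L && list_colourable G L]|%:R =
   'C(m, k)%:R ^+ n - #|[set L : lists n m | is_list_assignment k L && ~~ list_colourable G L]|%:R :> R.
  rewrite -natrX -card_list_assignments.
  rewrite -(cardsID [set L : lists n m | list_colourable G L] [set L : lists n m | is_list_assignment k L]) natrD.
  have -> : [set L : lists n m | is_list_assignment k L] :&: [set L : lists n m | list_colourable G L] =
    [set L : lists n m | is_list_assignment k L && list_colourable G L].
    by apply/setP => L; rewrite !inE.
  have -> : [set L : lists n m | is_list_assignment k L] :\: [set L : lists n m | list_colourable G L] =
    [set L : lists n m | is_list_assignment k L && ~~ list_colourable G L].
    by apply/setP => L; rewrite !inE andbC.
  by rewrite addrK.
rewrite e mulrBl divff ?gt_eqF // opprB addrC subrK ger0_norm ?divr_ge0 ?(ltW c0) //.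
by rewrite ler_pdivrMr.
Qed.

Lemma deg_le_maxdeg (n : nat) (G : rel 'I_n) (v : 'I_n) : (#|[set u | G v u]| <= maxdeg G)%N.
Proof. by rewrite -card_mkset; apply: (@leq_bigmax _ (fun v => #|[set u | G v u]%classic|)). Qed.

(* Expected number of minimal uncolourable sets of size [s]: the hypothesis on [m] turns each factor
   of [doubled_term_bound] into at most [n ^ (- e k / 4)], and [e k s / 4 >= 3]. *)
Lemma doubled_sum_bound (R : realType) (n m k N0 u D : nat) (e : R) :
  (0 < k)%N -> (0 < n)%N -> 0 < e -> 12 <= e * k%:R * N0%:R -> (0 < D)%N ->
  (2 * k <= m)%N -> n%:R `^ e * D%:R `^ (2 / k%:R) <= m%:R ->
  100 * k%:R ^+ k * (2 * k)%:R ^+ k * 32 ^+ k.+1 * u%:R ^+ k.+1 <= n%:R `^ (e * k%:R / 4) ->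
  \sum_(s < n.+1 | (N0 <= s < 32 * u)%N) n%:R * (s * maxn D 100)%:R ^+ s * m%:R ^+ (k * s)./2 *
     (k * s)%:R ^+ (k * s) / 'C(m, k)%:R ^+ s <= 2 / n%:R :> R.
Proof.
move=> k0 n0 e0 eN D0 km hm hu; set d := maxn D 100.
have nR : 1 <= n%:R :> R by rewrite ler1n.
have nR0 : 0 < n%:R :> R by lra.
have kR : 0 < k%:R :> R by rewrite ltr0n.
have DR : 1 <= D%:R :> R by rewrite ler1n.
set h := n%:R `^ _ in hu.
have h0 : 0 < h by apply: powR_gt0.
(* The lower bound on [m] raised to the power [k / 2]. One factor [h] absorbs the logarithms in
   [hu]; the other is the gain per vertex. *)
have mu : h ^+ 2 * D%:R <= m%:R `^ (k%:R / 2).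
  have -> : h ^+ 2 * D%:R = (n%:R `^ e * D%:R `^ (2 / k%:R)) `^ (k%:R / 2).
    rewrite powRM ?powR_ge0 // -!powRrM; congr (_ * _).
      rewrite /h -powR_mulrn ?powR_ge0 // -powRrM; congr (_ `^ _).
      by field.
    have -> : 2 / k%:R * (k%:R / 2) = 1 :> R by field; rewrite gt_eqF.
    by rewrite powRr1.
  by apply: ge0_ler_powR; rewrite ?nnegrE ?mulr_ge0 ?powR_ge0 ?divr_ge0 // ltW.
have mu0 : 0 < m%:R `^ (k%:R / 2) :> R.
  by apply: powR_gt0; rewrite ltr0n (leq_trans _ km) // muln_gt0.
have term (s : 'I_n.+1) : (N0 <= s < 32 * u)%N ->
    n%:R * (s * d)%:R ^+ s * m%:R ^+ (k * s)./2 * (k * s)%:R ^+ (k * s) / 'C(m, k)%:R ^+ s <=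
    n%:R^-1 ^+ 2 :> R.
  move=> /andP[Ns su]; apply: le_trans (@doubled_term_bound R n m k d s k0 km) _.
  set V := _ / _.
  have V0 : 0 <= V by rewrite /V divr_ge0 ?mulr_ge0 ?exprn_ge0 // ltW.
  have dD : (d <= 100 * D)%N by rewrite /d geq_max leq_pmull //= leq_pmulr.
  have Vh : V <= h^-1.
    rewrite /V ler_pdivrMr // [leRHS]mulrC ler_pdivlMr //.
    apply: le_trans mu; have -> : h ^+ 2 * D%:R = D%:R * h * h by ring.
    rewrite ler_wpM2r ?(ltW h0) //; apply: le_trans (ler_wpM2l _ hu); last by rewrite (le_trans _ DR).
    rewrite -!natrX -!natrM ler_nat.
    apply: (@leq_trans ((32 * u) * (100 * D) * (k * (32 * u)) ^ k * (2 * k) ^ k)).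
      rewrite leq_mul2r; apply/orP; right; rewrite !leq_mul ?leq_exp2r // ?leq_mul2l ?(ltnW su) ?orbT //.
    by rewrite !expnMn !expnS; apply: eq_leq; ring.
  (* The exponent 3: one for the factor [n], one for the at most [n.+1] sizes [s], one to tend to
     0. *)
  have hs : h^-1 ^+ s <= n%:R^-1 ^+ 3.
    rewrite !exprVn lef_pV2 ?posrE ?exprn_gt0 //.
    rewrite -!powR_mulrn ?(ltW h0) ?ler0n // /h -powRrM; apply: ler_powR => //.
    have sR : N0%:R <= s%:R :> R by rewrite ler_nat.
    have ek : 0 < e * k%:R by rewrite mulr_gt0.
    have : e * k%:R * N0%:R <= e * k%:R * s%:R by rewrite ler_wpM2l // ltW.
    lra.
  apply: (@le_trans _ _ (n%:R * n%:R^-1 ^+ 3)).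
    rewrite ler_wpM2l //; apply: le_trans hs; rewrite lerXn2r ?nnegrE ?invr_ge0 ?(ltW h0) //.
  by rewrite exprS mulrA divff ?mul1r // gt_eqF.
apply: (@le_trans _ _ (\sum_(s < n.+1) n%:R^-1 ^+ 2)).
  rewrite big_mkcond; apply: ler_sum => s _; case: ifP => [/term//|_].
  by rewrite exprn_ge0 // invr_ge0.
rewrite sumr_const card_ord -(mulr_natr (n%:R^-1 ^+ 2)) -natr1.
have -> : n%:R^-1 ^+ 2 * (n%:R + 1) = (n%:R + 1) / n%:R / n%:R :> R by field; rewrite gt_eqF.
by rewrite ler_wpM2r ?invr_ge0 // ler_pdivrMr //; lra.
Qed.

(** The common reduction of the three parts to a lower bound [N0] on the size of sets that are not
    [k]-choosable. *)
Lemma aas_of_choosable (R : realType) (k N0 : nat) (e : R) (G : forall n, rel 'I_n)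
    (m : nat -> nat) :
  (0 < k)%N -> (0 < N0)%N -> 0 < e -> 12 <= e * k%:R * N0%:R ->
  (forall n, simple_graph (G n)) -> (forall n, (3 * k ^ 2 * maxdeg (G n) <= m n)%N) ->
  (forall n (L : 'I_n -> {set 'I_(m n)}) (S : {set 'I_n}), (0 < m n)%N ->
     (forall v, v \in S -> #|L v| = k) -> (#|S| < N0)%N -> colourable_on (G n) L S) ->
  threshold_diverges k e G m -> aas_colourable R k G m.
Proof.
move=> k0 N00 e0 eN sG hm choos /cvgryPge/(_ 1)[n1 _ hn1].
(* This makes [m] at least [3 k^2 * 100], so that the degree bound may be raised to 100 as
   [explore_super] requires. *)
have [n2 hn2] := @polylog_le_powR R e (2 * k + 300 * k ^ 2)%:R 0 e0.
have kR : 0 < k%:R :> R by rewrite ltr0n.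
have a0 : 0 < e * k%:R / 4 by rewrite divr_gt0 // mulr_gt0.
have [n3 hn3] := @polylog_le_powR R (e * k%:R / 4)
   (100 * k%:R ^+ k * (2 * k)%:R ^+ k * 32 ^+ k.+1) k.+1 a0.
apply/cvgrPdist_le => eps eps0.
exists (maxn 1 (maxn n1 (maxn n2 (maxn n3 (Num.bound (6 / eps)))))) => // n /=.
rewrite !geq_max => /and5P[n0 /hn1 {}hn1 /hn2 {}hn2 /hn3 {}hn3 nb].
have nR0 : 0 < n%:R :> R by rewrite ltr0n.
apply: (@le_trans _ _ (6 / n%:R)); last first.
  rewrite ler_pdivrMr // mulrC -ler_pdivrMr //.
  apply: le_trans (ltW (archi_boundP _)) _; last by rewrite ler_nat.
  by rewrite divr_ge0 // ltW.
set D := maxdeg (G n) in hn1 *.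
(* For [D = 0] the denominator of the threshold vanishes and the quotient is 0 by convention,
   against [hn1]. *)
have D0 : (0 < D)%N.
  rewrite lt0n; apply/eqP => D0; move: hn1; rewrite -/D D0 powR0 ?mulr0 ?invr0 ?mulr0 ?ler10 //.
  by rewrite gt_eqF // divr_gt0.
have den : 0 < n%:R `^ e * D%:R `^ (2 / k%:R) :> R by rewrite mulr_gt0 ?powR_gt0 ?ltr0n.
have hmR : n%:R `^ e * D%:R `^ (2 / k%:R) <= (m n)%:R by move: hn1; rewrite ler_pdivlMr // mul1r.
have hm2 : (2 * k + 300 * k ^ 2 <= m n)%N.
  rewrite -(ler_nat R); move: hn2; rewrite expr0 mulr1 => /le_trans; apply.
  apply: le_trans hmR; rewrite ler_peMr ?powR_ge0 //.
  rewrite -[leLHS](powRr0 D%:R); apply: ler_powR; first by rewrite ler1n.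
  by rewrite divr_ge0 // ltW.
have k2 : (2 * k <= m n)%N by apply: leq_trans hm2; apply: leq_addr.
have km : (k <= m n)%N by apply: leq_trans k2; rewrite leq_pmull.
have m0 : (0 < m n)%N by apply: leq_trans km.
set d := maxn D 100.
have d100 : (100 <= d)%N by rewrite leq_maxr.
have hmd : (3 * k ^ 2 * d <= m n)%N.
  by rewrite /d maxnMr geq_max hm mulnAC; apply: leq_trans hm2; apply: leq_addl.
have [Dd super] := @explore_super R k (m n) d d100 m0 hmd.
have [Gs Gi] := sG n.
have degG v : (#|[set u | G n v u]| <= d)%N.
  by apply: leq_trans (deg_le_maxdeg _ _) (leq_maxl _ _).
set u := (trunc_log 2 n).+1 in hn3.
have d0 : (0 < d)%N by apply: leq_trans d100.
have B1 : 1 <= 21 / 20 :> R by lra.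
have D1 : 1 <= 1 + d%:R^-1 :> R by rewrite lerDl invr_ge0.
apply: prob_uncolourable => //.
have := @card_uncolourable R n (m n) k d N0 (32 * u) (G n) _ _ Gs Gi k0 km d0 N00 B1 D1 super degG
  (fun L S => choos n L S m0).
move=> /le_trans; apply; rewrite ler_wpM2r ?exprn_ge0 //.
have sum := @doubled_sum_bound R n (m n) k N0 u D e k0 n0 e0 eN D0 _ hmR hn3.
apply: (@le_trans _ _ (4 / n%:R + 2 / n%:R)); last by rewrite -mulrDl ler_wpM2r ?invr_ge0 //; lra.
apply: lerD; last exact: sum.
rewrite /explore_bound muln1 expr0 divr1 expr1.
(* [(21/20)^16 >= 2] and [2^u > n], so exploring up to [32 u] vertices gains [n^2]. *)
have B32 : (n%:R : R) ^+ 2 <= (21 / 20) ^+ (32 * u).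
  apply: (@le_trans _ _ (((2 : R) ^+ u) ^+ 2)).
    rewrite lerXn2r ?nnegrE ?exprn_ge0 // -natrX ler_nat; apply: ltnW.
    exact: trunc_log_ltn.
  rewrite exprAC exprM lerXn2r ?nnegrE ?exprn_ge0 //; lra.
have nsq : 0 < (n%:R : R) ^+ 2 by rewrite exprn_gt0.
apply: (@le_trans _ _ (n%:R * (21 / 20 / n%:R ^+ 2 * (281 / 100)))).
  rewrite ler_wpM2l // ler_pM // ?divr_ge0 ?exprn_ge0 // ?(le_trans ler01 D1) //; try lra.
  by rewrite ler_wpM2l ?lef_pV2 ?posrE ?exprn_gt0 //; lra.
have -> : n%:R * (21 / 20 / n%:R ^+ 2 * (281 / 100)) = (21 / 20 * (281 / 100)) / n%:R :> R.
  by field; rewrite gt_eqF.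
by rewrite ler_wpM2r ?invr_ge0 //; lra.
Qed.

(** * From fractional bounds to choosability of small sets *)

Lemma frac_chi_le_mono (R : realType) (n : nat) (G : rel 'I_n) (S : {set 'I_n}) (q q' : R) :
  q <= q' -> frac_chi_le G S q -> frac_chi_le G S q'.
Proof.
move=> qq h w w0; have [I [IS stI hI]] := h w w0; exists I; split=> //.
by apply: le_trans hI _; rewrite ler_wpM2r // sumr_ge0.
Qed.

(** Provides the smallness hypothesis of [split_lists] for sets of at most [k^j] vertices. *)
Lemma poly_lt_exp (R : realType) (j : nat) :
  exists k0, forall k, (k0 <= k)%N -> 2 * k%:R ^+ j * (337 / 384) ^+ k < 1 :> R.
Proof.
pose de : R := 47 / 384; pose b := de ^+ j.+1 / (j.+1)`!%:R.
have de0 : 0 < de by rewrite /de; lra.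
have b0 : 0 < b by rewrite divr_gt0 ?exprn_gt0 // ltr0n fact_gt0.
exists (Num.bound (2 / b)) => k hk.
have kb : 2 <= b * k%:R.
  rewrite mulrC -ler_pdivrMr //; apply: le_trans (ltW (archi_boundP _)) _; last by rewrite ler_nat.
  by rewrite divr_ge0 // ltW.
have x0 : 0 <= de * k%:R by rewrite mulr_ge0 // ltW.
have big : 2 * k%:R ^+ j < expR (de * k%:R).
  apply: lt_le_trans (expR_ge1Dxn j x0).
  rewrite exprMn mulrAC -/b exprS mulrA; apply: (@le_lt_trans _ _ (b * k%:R * k%:R ^+ j)).
    by rewrite ler_wpM2r ?exprn_ge0.
  by rewrite ltrDr.
have small : (337 / 384) ^+ k <= expR (- (de * k%:R)).
  have r0 : 0 <= 337 / 384 :> R by lra.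
  rewrite -mulNr expRM_natr lerXn2r ?nnegrE ?r0 ?expR_ge0 //.
  by apply: le_trans (expR_ge1Dx _); rewrite /de; lra.
apply: (@le_lt_trans _ _ (2 * k%:R ^+ j * expR (- (de * k%:R)))).
  by rewrite ler_wpM2l ?mulr_ge0 ?exprn_ge0.
by rewrite expRN ltr_pdivrMr ?expR_gt0 // mul1r.
Qed.

Lemma ln_le_linear (R : realType) (C : R) :
  exists k0, forall k, (k0 <= k)%N -> C * ln (k%:R : R) <= k%:R.
Proof.
have [k0 h] := @polylog_le_powR R 1 `|C| 1 ltr01.
exists (maxn 1 k0) => k; rewrite geq_max => /andP[k1 /h]; rewrite powRr1 // expr1.
apply: le_trans; have l0 : 0 <= ln (k%:R : R) by rewrite ln_ge0 // ler1n.
apply: (@le_trans _ _ (`|C| * ln k%:R)); first by rewrite ler_wpM2r // ler_norm.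
rewrite ler_wpM2l //; apply: (@le_trans _ _ (ln (2 ^+ (trunc_log 2 k).+1))).
  rewrite ler_ln ?posrE ?exprn_gt0 ?ltr0n // -natrX ler_nat ltnW //.
  exact: trunc_log_ltn.
rewrite lnXn // -[leLHS]mulr_natr -[leRHS]mul1r ler_wpM2r //.
by apply: le_trans (le_ln1Dx (_ : -1 < 1)) _; lra.
Qed.

(* With [t ^ b ~ k / log k] and [z ^ a ~ log k], sets of size at most [(t z) ^ a] are handled by
   [two_phase]: the first phase gains the factor [z ^ a] because [z ^ b.+1 <= log k]. *)
Lemma fractional_choosable (R : realType) (a b K : nat) :
  (0 < b)%N -> (b < a)%N -> (0 < K)%N ->
  exists c : R, 0 < c /\ exists k0 : nat, forall k : nat, (k0 <= k)%N ->
  exists N0 : nat, [/\ (0 < N0)%N, 1 <= ln (k%:R : R),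
    c * k%:R `^ (a%:R / b%:R) * ln k%:R `^ (- ((a - b)%:R / b%:R)) <= N0%:R &
    forall (n : nat) (C : finType) (c0 : C) (G : rel 'I_n) (L : 'I_n -> {set C}) (S : {set 'I_n}),
      (forall (t : nat) (U : {set 'I_n}), (0 < t)%N -> (#|U| <= t ^ a)%N ->
         frac_chi_le G U ((K * t ^ b)%:R : R)) ->
      (forall v, v \in S -> #|L v| = k) -> (#|S| < N0)%N -> colourable_on G L S].
Proof.
move=> b0 ba K0.
have a0 : (0 < a)%N by apply: leq_ltn_trans ba.
have bR : 0 < b%:R :> R by rewrite ltr0n.
have aR : 0 < a%:R :> R by rewrite ltr0n.
have KR : 0 < K%:R :> R by rewrite ltr0n.
(* Given [t^b log k <= ep k], both phases come down to [4 K a ep k < k]: the first by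
   [z^a <= exp(a z)] and [z^(b+1) <= log k], the second by [t^a <= exp(a log k)]. This [ep] makes
   the left side [k / 2]. *)
pose ep : R := (8 * K%:R * a%:R)^-1.
have ep0 : 0 < ep by rewrite invr_gt0 !mulr_gt0.
have epE : 4 * K%:R * a%:R * ep = 1 / 2 by rewrite /ep; field; rewrite !gt_eqF.
exists ((4^-1) ^+ a * ep `^ (a%:R / b%:R)); split.
  by apply: mulr_gt0; [apply: exprn_gt0; lra|apply: powR_gt0].
have [k1 hk1] := @poly_lt_exp R (2 * a); have [k2 hk2] := @ln_le_linear R ep^-1.
have ep1 : ep <= 1.
  have KR1 : 1 <= K%:R :> R by rewrite ler1n.
  have aR1 : 1 <= a%:R :> R by rewrite ler1n.
  by rewrite invf_le1 ?mulr_gt0 //; nra.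
exists (maxn 3 (maxn k1 k2)) => k; rewrite !geq_max => /and3P[k3 {}/hk1 hk1 {}/hk2 hk2].
have kR : 0 < k%:R :> R by rewrite ltr0n; apply: leq_trans k3.
set La := ln k%:R in hk2 *.
have eLa : expR La = k%:R by rewrite lnK ?posrE.
have La1 : 1 <= La.
  rewrite -ler_expR eLa; apply: le_trans (expR1_bound R) _.
  by apply: (@le_trans _ _ 3%:R); [lra|rewrite ler_nat].
have La0 : 0 < La by lra.
have Lak : La <= k%:R by rewrite -eLa; apply: le_trans (expR_ge1Dx _); lra.
pose x := ep * k%:R / La.
have x1 : 1 <= x.
  by rewrite /x ler_pdivlMr // mul1r mulrC -ler_pdivrMr // mulrC.
pose y := x `^ (b%:R^-1); pose yz := La `^ (a%:R^-1).
have y1 : 1 <= y by rewrite -[leLHS](powRr0 x); apply: ler_powR => //; rewrite invr_ge0 ltW.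
have yz1 : 1 <= yz by rewrite -[leLHS](powRr0 La); apply: ler_powR => //; rewrite invr_ge0 ltW.
have yb : y ^+ b = x.
  rewrite -powR_mulrn ?powR_ge0 // /y -powRrM mulVf ?gt_eqF // powRr1 //; lra.
have yza : yz ^+ a = La.
  rewrite -powR_mulrn ?powR_ge0 // /yz -powRrM mulVf ?gt_eqF // powRr1 //; lra.
(* Rounding loses a factor at most 2 in each of [t] and [z], hence the factor [(4^-1) ^+ a] in the
   constant. *)
have floor (w : R) : 1 <= w -> exists t : nat, [/\ (0 < t)%N, t%:R <= w & w <= 2 * t%:R].
  move=> w1; have w0 : 0 <= w by lra.
  have /andP[h1 h2] := truncn_itv w0; exists (Num.truncn w).
  have t0 : (0 < Num.truncn w)%N by rewrite truncn_gt0.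
  split=> //; have : 1 <= (Num.truncn w)%:R :> R by rewrite ler1n.
  by move: h2; rewrite -natr1; lra.
have [t [t0 ty yt]] := floor y y1; have [z [z0 zy yt']] := floor yz yz1.
have tb : t%:R ^+ b <= x by rewrite -yb lerXn2r ?nnegrE //; lra.
have za : z%:R ^+ a <= La by rewrite -yza lerXn2r ?nnegrE //; lra.
have t1R : 1 <= t%:R :> R by rewrite ler1n.
have z1R : 1 <= z%:R :> R by rewrite ler1n.
have tLa : t%:R ^+ b * La <= ep * k%:R by rewrite -ler_pdivlMr.
exists ((t * z) ^ a).+1; split=> //.
- apply: (@le_trans _ _ ((t * z) ^ a)%:R); last by rewrite ler_nat.
  have hz : La <= 2 ^+ a * z%:R ^+ a by rewrite -yza -exprMn lerXn2r ?nnegrE ?mulr_ge0 //; lra.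
  have hx : x `^ (a%:R / b%:R) <= 2 ^+ a * t%:R ^+ a.
    rewrite -exprMn [a%:R / _]mulrC powRrM -/y powR_mulrn; last by lra.
    by rewrite lerXn2r ?nnegrE ?mulr_ge0 //; lra.
  (* The factor [La] regained by [z ^ a] lowers the exponent of [1 / log k] from [a / b] to
     [(a - b) / b]. *)
  have e1 : ep `^ (a%:R / b%:R) * k%:R `^ (a%:R / b%:R) * La `^ (- ((a - b)%:R / b%:R)) =
      x `^ (a%:R / b%:R) * La.
    rewrite /x !powRM ?mulr_ge0 ?invr_ge0 ?(ltW ep0) ?(ltW La0) ?(ltW kR) // -!mulrA; do 2 congr (_ * _).
    rewrite -(powR_inv1 (ltW La0)) -powRrM -{3}(powRr1 (ltW La0)) -powRD; last by apply/implyP => _; rewrite gt_eqF.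
    congr (_ `^ _); rewrite natrB; last exact: ltnW.
    by field; rewrite ?gt_eqF.
  have -> : (4^-1) ^+ a * ep `^ (a%:R / b%:R) * k%:R `^ (a%:R / b%:R) * La `^ (- ((a - b)%:R / b%:R)) =
      (4^-1) ^+ a * (x `^ (a%:R / b%:R) * La) by rewrite -e1 !mulrA.
  rewrite natrX natrM exprMn.
  have -> : t%:R ^+ a * z%:R ^+ a = (4^-1) ^+ a * ((2 ^+ a * t%:R ^+ a) * (2 ^+ a * z%:R ^+ a)) :> R.
    have q : (4^-1 : R) ^+ a * (2 ^+ a * 2 ^+ a) = 1.
      by rewrite -!exprMn (_ : 4^-1 * (2 * 2) = 1) ?expr1n //; field.
    transitivity ((4^-1 : R) ^+ a * (2 ^+ a * 2 ^+ a) * (t%:R ^+ a * z%:R ^+ a)); first by rewrite q mul1r.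
    by move: ((4^-1 : R) ^+ a) ((2 : R) ^+ a) (t%:R ^+ a) (z%:R ^+ a) => A B T Z; ring.
  rewrite ler_wpM2l ?exprn_ge0 ?invr_ge0 //; apply: ler_pM => //; first exact: powR_ge0.
  exact: ltW.
move=> n C c0 G L S hfrac hL; rewrite ltnS => hS.
have q0 s : (0 < s)%N -> 1 <= (K * s ^ b)%:R :> R.
  by move=> s0; rewrite ler1n muln_gt0 K0 expn_gt0 s0.
have tz0 : (0 < t * z)%N by rewrite muln_gt0 t0.
(* At most [t ^ a] vertices survive the first phase, so the second one works with [t] in place of
   [t * z]. *)
apply: (@two_phase R n k C c0 G L S _ _ (t ^ a) (q0 _ tz0) (q0 _ t0)).
- exact: hfrac.
- by move=> U _; apply: hfrac.
- exact: hL.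
- have r0 : 0 <= 337 / 384 :> R by lra.
  apply: le_lt_trans hk1; rewrite ler_wpM2r ?exprn_ge0 ?r0 //.
  rewrite ler_wpM2l // -natrX ler_nat; apply: leq_trans hS _.
  rewrite expnM leq_exp2r // -mulnn leq_mul // -(ler_nat R).
    apply: (@le_trans _ _ (t%:R ^+ b)); first by rewrite ler_eXnr.
    apply: (@le_trans _ _ (t%:R ^+ b * La)); first by rewrite ler_peMr ?exprn_ge0.
    by apply: le_trans tLa _; rewrite ler_piMl ?(ltW kR).
  by apply: le_trans Lak; apply: le_trans za; rewrite ler_eXnr.
- have grow : (z ^ a)%:R <= expR (k%:R / (4 * (K * (t * z) ^ b)%:R)) :> R.
    apply: (@le_trans _ _ (expR (a%:R * z%:R))).
      rewrite expRM_natl natrX lerXn2r ?nnegrE ?expR_ge0 //.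
      by apply: le_trans (expR_ge1Dx _); lra.
    rewrite ler_expR ler_pdivlMr; last by rewrite mulr_gt0 // ltr0n muln_gt0 K0 expn_gt0 tz0.
    have zb : z%:R ^+ b * z%:R <= La.
      by apply: le_trans za; rewrite -exprSr ler_weXn2l.
    have : t%:R ^+ b * (z%:R ^+ b * z%:R) <= ep * k%:R.
      by apply: le_trans tLa; rewrite ler_wpM2l ?exprn_ge0.
    rewrite natrM natrX natrM exprMn => h.
    have -> : a%:R * z%:R * (4 * (K%:R * (t%:R ^+ b * z%:R ^+ b))) =
      4 * K%:R * a%:R * (t%:R ^+ b * (z%:R ^+ b * z%:R)) :> R by ring.
    apply: (@le_trans _ _ (4 * K%:R * a%:R * (ep * k%:R))).
      by rewrite ler_wpM2l // !mulr_ge0.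
    by rewrite mulrA epE; lra.
  rewrite expRN ltr_pdivrMr ?expR_gt0 //.
  apply: (@le_lt_trans _ _ ((t ^ a)%:R * expR (k%:R / (4 * (K * (t * z) ^ b)%:R)))).
    apply: le_trans (ler_wpM2l _ grow) => //; rewrite -natrM ler_nat -expnMn.
    exact: hS.
  by rewrite ltr_pM2r ?expR_gt0 // ltr_nat.
rewrite expRN ltr_pdivrMr ?expR_gt0 // mul1r.
have tk : t%:R <= expR La.
  rewrite eLa; apply: (@le_trans _ _ (t%:R ^+ b)); first by rewrite ler_eXnr.
  apply: (@le_trans _ _ (t%:R ^+ b * La)); first by rewrite ler_peMr ?exprn_ge0.
  by apply: le_trans tLa _; rewrite ler_piMl ?(ltW kR).
apply: (@le_lt_trans _ _ (expR (a%:R * La))).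
  by rewrite expRM_natl natrX lerXn2r ?nnegrE ?expR_ge0.
rewrite ltr_expR ltr_pdivlMr; last by rewrite mulr_gt0 // ltr0n muln_gt0 K0 expn_gt0 t0.
rewrite natrM natrX.
have -> : a%:R * La * (4 * (K%:R * t%:R ^+ b)) = 4 * K%:R * a%:R * (t%:R ^+ b * La) by ring.
apply: (@le_lt_trans _ _ (4 * K%:R * a%:R * (ep * k%:R))).
  by rewrite ler_wpM2l // !mulr_ge0.
by rewrite mulrA epE; lra.
Qed.

(** * The three forbidden subgraphs *)

Lemma aas_colourable_clique_free (R : realType) (r : nat) : (3 <= r)%N ->
  exists c : R, 0 < c /\ exists k0 : nat, forall k : nat, (k0 <= k)%N ->
  forall (G : forall n, rel 'I_n) (m : nat -> nat),
    (forall n, simple_graph (G n)) ->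
    (forall n, (3 * k ^ 2 * maxdeg (G n) <= m n)%N) ->
    (forall n, H_free (@complete_graph r) (G n)) ->
    threshold_diverges k
      (c * powR (k%:R : R) (- ((2 * r - 3)%:R / (r - 2)%:R))
         * powR (ln (k%:R : R)) (1 / (r - 2)%:R)) G m ->
    aas_colourable R k G m.
Proof.
case: r => [|[|[|s]]] // _; set b := s.+1.
have b0 : (0 < b)%N by [].
have [c1 [c10 [k0 h]]] := @fractional_choosable R b.+1 b b.+1 b0 (ltnSn b) (ltn0Sn b).
exists (12 / c1); split; first exact: divr_gt0.
exists (maxn 1 k0) => k; rewrite geq_max => /andP[kpos /h[N0 [N00 ln1 hN choos]]] G m sG hm hf.
have -> : (2 * s.+3 - 3)%N = (b + b.+1)%N by rewrite /b; lia.
have -> : (s.+3 - 2)%N = b by rewrite /b; lia.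
have kR : 0 < k%:R :> R by rewrite ltr0n.
have l0 : 0 < ln k%:R :> R by lra.
have bR : b%:R != 0 :> R by rewrite pnatr_eq0.
apply: (@aas_of_choosable R k N0) => //.
- by rewrite !mulr_gt0 ?powR_gt0 ?invr_gt0 //.
- move: hN; rewrite subSnn => hN; set e := _ * k%:R.
  have -> : e = 12 / (c1 * k%:R `^ (b.+1%:R / b%:R) * ln k%:R `^ (- (1%:R / b%:R))).
    (* The exponent [(2r-3)/(r-2)] is [(r-1)/(r-2)], from [N0], plus 1 from the factor [k] in
       [12 / (k N0)]. *)
    have ex : - ((b + b.+1)%:R / b%:R) = -1 - b.+1%:R / b%:R :> R.
      by rewrite (natrD _ b b.+1); field.
    rewrite /e ex powRD; last by apply/implyP => _; rewrite gt_eqF.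
    rewrite !powRN powRr1 ?(ltW kR) //; field.
    by rewrite !gt_eqF ?powR_gt0.
  rewrite mulrAC ler_pdivlMr; last by rewrite !mulr_gt0 ?powR_gt0.
  by rewrite ler_pM2l.
move=> n L S m0 hL hS; have [Gs Gi] := sG n.
apply: (choos n _ (Ordinal m0)) => // t U t0 hU.
by apply: frac_chi_clique_free => //; apply: hf.
Qed.

Lemma aas_colourable_odd_cycle_free (R : realType) (l : nat) : (2 <= l)%N ->
  exists c : R, 0 < c /\ exists k0 : nat, forall k : nat, (k0 <= k)%N ->
  forall (G : forall n, rel 'I_n) (m : nat -> nat),
    (forall n, simple_graph (G n)) ->
    (forall n, (3 * k ^ 2 * maxdeg (G n) <= m n)%N) ->
    (forall n, H_free (@cycle_graph (2 * l + 1)) (G n)) ->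
    threshold_diverges k
      (c * powR (k%:R : R) (- (l + 2)%:R) * (ln (k%:R : R)) ^+ l) G m ->
    aas_colourable R k G m.
Proof.
move=> l2; have l0 : (0 < l)%N by apply: leq_trans l2.
have K0 : (0 < 3 * odd_const l)%N by rewrite muln_gt0 expn_gt0.
(* The factor 3 makes the bound linear in [t]: [t + 2 <= 3 t]. *)
have [c1 [c10 [k0 h]]] := @fractional_choosable R l.+1 1 (3 * odd_const l) isT l0 K0.
exists (12 / c1); split; first exact: divr_gt0.
exists (maxn 1 k0) => k; rewrite geq_max => /andP[kpos /h[N0 [N00 ln1 hN choos]]] G m sG hm hf.
have kR : 0 < k%:R :> R by rewrite ltr0n.
have lR : 0 < ln k%:R :> R by lra.
apply: (@aas_of_choosable R k N0) => //.
- by rewrite !mulr_gt0 ?powR_gt0 ?invr_gt0 ?exprn_gt0 //.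
- rewrite (powR_invn _ (ltW kR)) addn2.
  move: hN; rewrite subSS subn0 !divr1 (powR_mulrn _ (ltW kR)) (powR_invn _ (ltW lR)) => hN.
  have -> : 12 / c1 * k%:R ^- l.+2 * ln k%:R ^+ l * k%:R * N0%:R =
      12 * (N0%:R / (c1 * k%:R ^+ l.+1 * ln k%:R ^- l)) :> R.
    by rewrite (exprS _ l.+1); field; rewrite !gt_eqF ?exprn_gt0.
  rewrite ler_peMr // ler_pdivlMr ?mul1r //.
  by rewrite !mulr_gt0 ?invr_gt0 ?exprn_gt0.
move=> n L S m0 hL hS; have [Gs Gi] := sG n.
apply: (choos n _ (Ordinal m0)) => // t U t0 hU.
apply: (@frac_chi_le_mono _ _ _ _ (odd_const l * (t + 2))%:R).
  by rewrite ler_nat expn1; nia.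
exact: frac_chi_odd_cycle_free.
Qed.

Lemma aas_colourable_even_cycle_free (R : realType) (l : nat) : (2 <= l)%N ->
  exists c : R, 0 < c /\ exists k0 : nat, forall k : nat, (k0 <= k)%N ->
  forall (G : forall n, rel 'I_n) (m : nat -> nat),
    (forall n, simple_graph (G n)) ->
    (forall n, (3 * k ^ 2 * maxdeg (G n) <= m n)%N) ->
    (forall n, H_free (@cycle_graph (2 * l)) (G n)) ->
    threshold_diverges k (c * powR (k%:R : R) (- (l + 1)%:R)) G m ->
    aas_colourable R k G m.
Proof.
move=> l2; have l0 : (0 < l)%N by apply: leq_trans l2.
have C0 := even_const_gt0 l; set q := ((4 * even_const l) ^ l)%N.
have q0 : (0 < q)%N by rewrite expn_gt0 muln_gt0 C0.
have qR : 0 < q%:R :> R by rewrite ltr0n.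
(* 24 instead of 12 pays for rounding [k ^ l / q] down to [N0]. *)
exists (24 * q%:R); split; first by rewrite mulr_gt0.
exists (12 * even_const l)%N => k hk G m sG hm hf.
have kpos : (0 < k)%N by apply: leq_trans hk; rewrite muln_gt0.
have kR : 0 < k%:R :> R by rewrite ltr0n.
have qk : (q <= k ^ l)%N.
  by rewrite leq_exp2r //; apply: leq_trans hk; rewrite leq_mul2r orbT.
set N0 := (k ^ l %/ q)%N.
have N00 : (0 < N0)%N by rewrite divn_gt0.
apply: (@aas_of_choosable R k N0) => //.
- by rewrite !mulr_gt0 ?powR_gt0 //.
- rewrite powR_invn ?(ltW kR) // addn1.
  have h : (k ^ l <= 2 * q * N0)%N.
    have := ltn_ceil (k ^ l) q0; rewrite -/N0 mulSn => h1.
    have : (q * 1 <= q * N0)%N by rewrite leq_mul2l N00 orbT.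
    by rewrite muln1 -mulnA [(q * N0)%N]mulnC; lia.
  have -> : 24 * q%:R * k%:R ^- l.+1 * k%:R * N0%:R = 12 * ((2 * q * N0)%:R / (k ^ l)%:R) :> R.
    rewrite natrX exprS !natrM; field.
    by rewrite !gt_eqF ?exprn_gt0.
  by rewrite ler_peMr // ler_pdivlMr ?ltr0n ?expn_gt0 ?kpos // mul1r ler_nat.
move=> n L S m0 hL hS; have [Gs Gi] := sG n.
apply: (even_cycle_free_colourable (Ordinal m0) Gs Gi (hf n) l0 hk hL).
rewrite -/q; apply: (@leq_trans (q * N0)); first by rewrite ltn_pmul2l.
by rewrite mulnC leq_trunc_div.
Qed.

Unset Implicit Arguments.

Theorem mainTheorem3 (R : realType) :
  (* (a) K_r-free *)
  (forall r : nat, (3 <= r)%N ->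
    exists c : R, 0 < c /\ exists k0 : nat, forall k : nat, (k0 <= k)%N ->
    forall (G : forall n, rel 'I_n) (m : nat -> nat),
      (forall n, simple_graph (G n)) ->
      (forall n, (3 * k ^ 2 * maxdeg (G n) <= m n)%N) ->
      (forall n, H_free (@complete_graph r) (G n)) ->
      threshold_diverges k
        (c * powR (k%:R : R) (- ((2 * r - 3)%:R / (r - 2)%:R))
           * powR (ln (k%:R : R)) (1 / (r - 2)%:R)) G m ->
      aas_colourable R k G m)
  /\
  (* (b) C_{2l+1}-free *)
  (forall l : nat, (2 <= l)%N ->
    exists c : R, 0 < c /\ exists k0 : nat, forall k : nat, (k0 <= k)%N ->
    forall (G : forall n, rel 'I_n) (m : nat -> nat),
      (forall n, simple_graph (G n)) ->
      (forall n, (3 * k ^ 2 * maxdeg (G n) <= m n)%N) ->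
      (forall n, H_free (@cycle_graph (2 * l + 1)) (G n)) ->
      threshold_diverges k
        (c * powR (k%:R : R) (- (l + 2)%:R) * (ln (k%:R : R)) ^+ l) G m ->
      aas_colourable R k G m)
  /\
  (* (c) C_{2l}-free *)
  (forall l : nat, (2 <= l)%N ->
    exists c : R, 0 < c /\ exists k0 : nat, forall k : nat, (k0 <= k)%N ->
    forall (G : forall n, rel 'I_n) (m : nat -> nat),
      (forall n, simple_graph (G n)) ->
      (forall n, (3 * k ^ 2 * maxdeg (G n) <= m n)%N) ->
      (forall n, H_free (@cycle_graph (2 * l)) (G n)) ->
      threshold_diverges k (c * powR (k%:R : R) (- (l + 1)%:R)) G m ->
      aas_colourable R k G m).
Proof.
split; first exact: aas_colourable_clique_free.
by split; [apply: aas_colourable_odd_cycle_free|apply: aas_colourable_even_cycle_free].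
Qed.
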